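(* Let $(R,\mathfrak m)$ be a local ring, $M$ a finitely generated $R$-module of dimension $d$, and $\underline{x}=(x_1,\ldots,x_d)$ a system of parameters for $M$. If $M$ is Cohen-Macaulay, then for all integers $i,j$ $$H_i^{\underline{x}}(H^j_{\mathfrak m}(M))\cong\begin{cases}\widehat{M} & \text{if } i=j=d,\\ 0 & \text{otherwise,}\end{cases}$$ where $\widehat{M}$ is the $\mathfrak m$-adic completion of $M$.
   Context: Local ring means commutative Noetherian local ring. $H^j_{\mathfrak m}(M)$ is the $j$-th local cohomology module of $M$ with respect to $\mathfrak m$ (an Artinian $R$-module here). Local homology: for a commutative quasi-local (not necessarily Noetherian) ring $(A,\mathfrak n)$, an Artinian $A$-module $X$, a sequence $\underline{x}=(x_1,\ldots,x_r)$ in $\mathfrak n$ and an integer $i$, the $i$-th local homology module of $X$ with respect to $\underline{x}$ is $$H_i^{\underline{x}}(X)=\varprojlim_{n} H_i(K_\bullet(x_1^n,\ldots,x_r^n;X)),$$ where $K_\bullet(x_1^n,\ldots,x_r^n;X)$ is the Koszul complex of $X$ with respect to $x_1^n,\ldots,x_r^n$, and the transition maps are induced by the standard maps of Koszul complexes $K_\bullet(x_1^{n+1},\ldots,x_r^{n+1};X)\to K_\bullet(x_1^n,\ldots,x_r^n;X)$ which multiply the component indexed by $e_{j_1}\wedge\cdots\wedge e_{j_p}$ by $x_{j_1}\cdots x_{j_p}$. In particular, for $i=r$ the system is $\{0:_X(x_1^n,\ldots,x_r^n)\}_n$ with transition maps multiplication by $x_1\cdots x_r$. *)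

(* Defs.v *)
From HB Require Import structures.
From mathcomp Require Import all_boot all_order all_algebra.
From mathcomp Require Import all_classical.

Set Implicit Arguments.
Unset Strict Implicit.
Unset Printing Implicit Defensive.

Import GRing.Theory.
Local Open Scope ring_scope.
Local Open Scope quotient_scope.

(* Subsets are boolean predicates [{pred V}]; [`[< P >]] (from boolp) turns an
   arbitrary proposition into a boolean.  [submod_closed N] is the library's
   "N is a submodule"; an ideal of R is a submodule of the regular module R^o,
   whereas the library's [idealr_closed] means "proper ideal". *)

Section Submodules.
Variable R : comNzRingType.

Definition gen_submod (V : lmodType R) (S : {pred V}) : {pred V} :=
  fun v => `[< forall N : {pred V},
                 submod_closed N -> {subset S <= N} -> v \in N >].

Lemma gen_submod_closed (V : lmodType R) (S : {pred V}) :
  submod_closed (gen_submod S).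
Proof.
split; first by apply/asboolP => N [].
move=> a u v /asboolP uS /asboolP vS; apply/asboolP => N NC SN.
by case: (NC) => _; apply; [exact: uS | exact: vS].
Qed.
HB.instance Definition _ V S :=
  GRing.isSubmodClosed.Build R V (gen_submod S) (gen_submod_closed S).

Lemma gen_submod_min (V : lmodType R) (S N : {pred V}) :
  submod_closed N -> {subset S <= N} -> {subset gen_submod S <= N}.
Proof. by move=> NC SN v /asboolP; apply. Qed.

Lemma mem_gen_submod (V : lmodType R) (S : {pred V}) : {subset S <= gen_submod S}.
Proof. by move=> v vS; apply/asboolP => N _; apply. Qed.

(* The submodule I N of V. *)
Definition ideal_smul (V : lmodType R) (I : {pred R}) (N : {pred V}) : {pred V} :=
  gen_submod (fun v : V => `[< exists a u, [/\ a \in I, u \in N & v = a *: u] >]).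
HB.instance Definition _ V I N :=
  GRing.isSubmodClosed.Build R V (@ideal_smul V I N) (gen_submod_closed _).

Lemma ideal_smulS (V W : lmodType R) (f : {linear V -> W}) (I J : {pred R})
    (N : {pred V}) (N' : {pred W}) :
    {subset I <= J} -> {in N, forall u, f u \in N'} ->
  {in ideal_smul I N, forall v, f v \in ideal_smul J N'}.
Proof.
move=> IJ NN'.
apply: (@gen_submod_min V _ (fun v => f v \in ideal_smul J N')).
  split=> [|a u v fu fv].
    by change (f 0 \in ideal_smul J N'); rewrite linear0 rpred0.
  change (f (a *: u + v) \in ideal_smul J N').
  by rewrite linearP rpredD // rpredZ.
move=> v /asboolP[a [u [aI uN ->]]]; change (f (a *: u) \in ideal_smul J N').
rewrite linearZ.
by apply: mem_gen_submod; apply/asboolP; exists a, (f u); split; auto.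
Qed.

Definition ideal_pow (I : {pred R}) (n : nat) : {pred R} :=
  iter n (@ideal_smul R^o I) predT.

Lemma ideal_powS (I : {pred R}) n : {subset ideal_pow I n.+1 <= ideal_pow I n}.
Proof.
elim: n => [|n IHn] //= x.
exact: (@ideal_smulS R^o R^o idfun I I (ideal_pow I n.+1) (ideal_pow I n)).
Qed.

Lemma ideal_pow_le (I : {pred R}) n k :
  (n <= k)%N -> {subset ideal_pow I k <= ideal_pow I n}.
Proof.
move=> /subnK <-; elim: (k - n)%N => [|l IHl] x //.
by rewrite addSn => /ideal_powS; exact: IHl.
Qed.

Definition ideal_gen (s : seq R) : {pred R} := @gen_submod R^o (mem s).

(* Submodules as modules in their own right. *)
Section SubMod.
Variables (V : lmodType R) (N : submodClosed V).
Record sub_mod := SubMod { sub_mod_val : V; _ : sub_mod_val \in (N : {pred V}) }.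
HB.instance Definition _ := [isSub for sub_mod_val].
HB.instance Definition _ := [Choice of sub_mod by <:].
HB.instance Definition _ := [SubChoice_isSubLmodule of sub_mod by <:].
End SubMod.

(* The library's quotient group V / N, with its R-module structure. *)
Section QuotMod.
Variables (V : lmodType R) (N : submodClosed V).
(* The library's [submodClosed] does not record closure under opposites. *)
Definition sub_group : {pred V} := N.
HB.instance Definition _ :=
  GRing.isZmodClosed.Build V sub_group (submodClosedP N : zmod_closed sub_group).

Definition quot_mod := Quotient.quot sub_group.
HB.instance Definition _ := GRing.Zmodule.on quot_mod.

Definition quot_pi : V -> quot_mod := \pi_(Quotient.quot sub_group).
Definition quot_repr (q : quot_mod) : V := repr (q : Quotient.quot sub_group).

Lemma quot_reprK : cancel quot_repr quot_pi.
Proof. exact: reprK. Qed.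

Lemma quot_piE u v : (quot_pi u == quot_pi v) = (u - v \in (N : {pred V})).
Proof. by rewrite -[_ == _]/(u == v %[mod Quotient.quot sub_group]) -Quotient.idealrBE. Qed.

Lemma quot_piD : {morph quot_pi : u v / u + v}.
Proof. by move=> u v; rewrite /quot_pi raddfD. Qed.

Lemma quot_reprE u : quot_repr (quot_pi u) - u \in (N : {pred V}).
Proof. by rewrite -quot_piE quot_reprK. Qed.

Definition quot_scale (a : R) (q : quot_mod) := quot_pi (a *: quot_repr q).

Lemma quot_scaleE a u : quot_scale a (quot_pi u) = quot_pi (a *: u).
Proof. by apply/eqP; rewrite quot_piE -scalerBr rpredZ // quot_reprE. Qed.

Lemma quot_scaleA a b q : quot_scale a (quot_scale b q) = quot_scale (a * b) q.
Proof. by rewrite -[q]quot_reprK !quot_scaleE scalerA. Qed.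
Lemma quot_scale1 : left_id 1 quot_scale.
Proof. by move=> q; rewrite -[q]quot_reprK quot_scaleE scale1r. Qed.
Lemma quot_scaleDr : right_distributive quot_scale +%R.
Proof.
move=> a p q; rewrite -[p]quot_reprK -[q]quot_reprK -quot_piD !quot_scaleE.
by rewrite scalerDr quot_piD.
Qed.
Lemma quot_scaleDl q : {morph quot_scale^~ q : a b / a + b}.
Proof.
by move=> a b; rewrite -[q]quot_reprK !quot_scaleE scalerDl quot_piD.
Qed.
HB.instance Definition _ := GRing.Zmodule_isLmodule.Build R quot_mod
  quot_scaleA quot_scale1 quot_scaleDr quot_scaleDl.

Lemma quot_pi_linear : linear quot_pi.
Proof. by move=> a u v; rewrite quot_piD -quot_scaleE. Qed.
HB.instance Definition _ := GRing.isLinear.Build R V quot_mod *:%R quot_pi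
  quot_pi_linear.
End QuotMod.

(* Maps induced on submodules and on quotients by a linear map. *)
Section SubModMap.
Variables (V W : lmodType R) (N : submodClosed V) (N' : submodClosed W).
Variables (f : {linear V -> W}) (fN : {in (N : {pred V}), forall v, f v \in (N' : {pred W})}).
Definition sub_mod_map (u : sub_mod N) : sub_mod N' := SubMod (fN (valP u)).
Lemma sub_mod_map_linear : linear sub_mod_map.
Proof. by move=> a u v; apply: val_inj; rewrite /= !linearP. Qed.
HB.instance Definition _ := GRing.isLinear.Build R (sub_mod N) (sub_mod N') *:%R
  sub_mod_map sub_mod_map_linear.
End SubModMap.

Section QuotModMap.
Variables (V W : lmodType R) (N : submodClosed V) (N' : submodClosed W).
Variables (f : {linear V -> W}) (fN : {in (N : {pred V}), forall v, f v \in (N' : {pred W})}).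
Definition quot_mod_map of {in (N : {pred V}), forall v, f v \in (N' : {pred W})} :=
  fun q : quot_mod N => quot_pi N' (f (quot_repr q)).
Lemma quot_mod_mapE v : quot_mod_map fN (quot_pi N v) = quot_pi N' (f v).
Proof. by apply/eqP; rewrite quot_piE -linearB fN // quot_reprE. Qed.
Lemma quot_mod_map_linear : linear (quot_mod_map fN).
Proof.
move=> a p q; rewrite -[p]quot_reprK -[q]quot_reprK -linearP !quot_mod_mapE.
by rewrite !linearP.
Qed.
HB.instance Definition _ := GRing.isLinear.Build R (quot_mod N) (quot_mod N') *:%R
  (quot_mod_map fN) quot_mod_map_linear.
End QuotModMap.

Definition preim_submod (V W : lmodType R) (f : V -> W) (N : {pred W}) : {pred V} :=
  fun v => f v \in N.
Lemma preim_submod_closed (V W : lmodType R) (f : {linear V -> W}) (N : submodClosed W) :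
  submod_closed (preim_submod f N).
Proof.
split=> [|a u v fu fv].
  by change (f 0 \in (N : {pred W})); rewrite linear0 rpred0.
change (f (a *: u + v) \in (N : {pred W})).
by rewrite linearP rpredD // rpredZ.
Qed.
HB.instance Definition _ (V W : lmodType R) (f : {linear V -> W}) (N : submodClosed W) :=
  GRing.isSubmodClosed.Build R V (preim_submod f N) (preim_submod_closed f N).

(* The image of Z in V / B, for submodules Z and B of V: when B is contained in
   Z (as for cycles and boundaries) this is Z / B. *)
Definition subquot (V : lmodType R) (Z B : submodClosed V) : lmodType R :=
  quot_mod (preim_submod (val : {linear sub_mod Z -> V}) B).

Section SubquotMap.
Variables (V W : lmodType R) (Z B : submodClosed V) (Z' B' : submodClosed W).
Variables (f : {linear V -> W}).
Hypothesis fZ : {in (Z : {pred V}), forall v, f v \in (Z' : {pred W})}.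
Hypothesis fB : {in (B : {pred V}), forall v, f v \in (B' : {pred W})}.
Lemma subquot_map_proof :
  {in preim_submod (val : sub_mod Z -> V) B, forall v,
     sub_mod_map fZ v \in preim_submod (val : sub_mod Z' -> W) B'}.
Proof. by move=> v vB; exact: fB vB. Qed.
Definition subquot_map : {linear subquot Z B -> subquot Z' B'} :=
  quot_mod_map subquot_map_proof.
End SubquotMap.

(* The inverse limit of  ... -> H 2 -> H 1 -> H 0. *)
Section InverseLimit.
Variables (H : nat -> lmodType R) (phi : forall n, {linear H n.+1 -> H n}).
Record inv_lim := InvLim {
  inv_lim_proj : forall n, H n;
  inv_lim_compat : forall n, phi n (inv_lim_proj n.+1) = inv_lim_proj n }.

Lemma inv_lim_inj (u v : inv_lim) :
  (forall n, inv_lim_proj u n = inv_lim_proj v n) -> u = v.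
Proof.
case: u v => [u uP] [v vP] /= uv.
have {uv}uv : u = v by apply: functional_extensionality_dep.
by case: v / uv vP => vP; congr InvLim; exact: Prop_irrelevance.
Qed.

HB.instance Definition _ := gen_eqMixin inv_lim.
HB.instance Definition _ := gen_choiceMixin inv_lim.

Program Definition inv_lim0 := @InvLim (fun=> 0) _.
Next Obligation. by move=> *; rewrite linear0. Qed.
Program Definition inv_lim_add u v :=
  @InvLim (fun n => inv_lim_proj u n + inv_lim_proj v n) _.
Next Obligation. by move=> *; rewrite linearD !inv_lim_compat. Qed.
Program Definition inv_lim_opp u := @InvLim (fun n => - inv_lim_proj u n) _.
Next Obligation. by move=> *; rewrite linearN inv_lim_compat. Qed.
Program Definition inv_lim_scale (a : R) u :=
  @InvLim (fun n => a *: inv_lim_proj u n) _.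
Next Obligation. by move=> *; rewrite linearZ /= inv_lim_compat. Qed.

Lemma inv_lim_addA : associative inv_lim_add.
Proof. by move=> u v w; apply: inv_lim_inj => n /=; rewrite addrA. Qed.
Lemma inv_lim_addC : commutative inv_lim_add.
Proof. by move=> u v; apply: inv_lim_inj => n /=; rewrite addrC. Qed.
Lemma inv_lim_add0 : left_id inv_lim0 inv_lim_add.
Proof. by move=> u; apply: inv_lim_inj => n /=; rewrite add0r. Qed.
Lemma inv_lim_addN : left_inverse inv_lim0 inv_lim_opp inv_lim_add.
Proof. by move=> u; apply: inv_lim_inj => n /=; rewrite addNr. Qed.
HB.instance Definition _ := GRing.isZmodule.Build inv_lim
  inv_lim_addA inv_lim_addC inv_lim_add0 inv_lim_addN.

Lemma inv_lim_scaleA a b u :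
  inv_lim_scale a (inv_lim_scale b u) = inv_lim_scale (a * b) u.
Proof. by apply: inv_lim_inj => n /=; rewrite scalerA. Qed.
Lemma inv_lim_scale1 : left_id 1 inv_lim_scale.
Proof. by move=> u; apply: inv_lim_inj => n /=; rewrite scale1r. Qed.
Lemma inv_lim_scaleDr : right_distributive inv_lim_scale +%R.
Proof. by move=> a u v; apply: inv_lim_inj => n /=; rewrite scalerDr. Qed.
Lemma inv_lim_scaleDl u : {morph inv_lim_scale^~ u : a b / a + b}.
Proof. by move=> a b; apply: inv_lim_inj => n /=; rewrite scalerDl. Qed.
HB.instance Definition _ := GRing.Zmodule_isLmodule.Build R inv_lim
  inv_lim_scaleA inv_lim_scale1 inv_lim_scaleDr inv_lim_scaleDl.
End InverseLimit.

Definition zero_mod : lmodType R := 'rV[R]_0.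

Definition isomorphic (U V : lmodType R) : Prop :=
  exists f : {linear U -> V}, bijective f.

End Submodules.

Section CommutativeAlgebra.
Variable R : comNzRingType.

Definition noetherian : Prop :=
  forall I : {pred R}, @submod_closed R R^o I ->
    exists s : seq R, I =i ideal_gen s.

Definition maximal_ideal (m : {pred R}) : Prop :=
  idealr_closed m /\
  forall I : {pred R}, idealr_closed I -> {subset m <= I} -> I =i m.

(* (R, m) is quasi-local. *)
Definition is_local (m : {pred R}) : Prop :=
  maximal_ideal m /\ forall m' : {pred R}, maximal_ideal m' -> m' =i m.

Definition prime_ideal (p : {pred R}) : Prop :=
  idealr_closed p /\ prime_idealr_closed p.

Definition finitely_generated (M : lmodType R) : Prop :=
  exists s : seq M, gen_submod (mem s) =i predT.

(* A strictly increasing chain N_0 < ... < N_k of subsets satisfying P. *)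
Definition strict_chain (T : Type) (P : {pred T} -> Prop) (k : nat) : Prop :=
  exists N : nat -> {pred T},
    (forall i, (i <= k)%N -> P (N i)) /\
    (forall i, (i < k)%N ->
       {subset N i <= N i.+1} /\ ~ {subset N i.+1 <= N i}).

Definition is_largest (P : nat -> Prop) (d : nat) : Prop :=
  P d /\ forall k, P k -> (k <= d)%N.

Definition annihilator (M : lmodType R) : {pred R} :=
  fun a => `[< forall u : M, a *: u = 0 >].

(* The Krull dimension of R / Ann M, through the primes of R containing Ann M.
   No d satisfies this when M = 0. *)
Definition has_dim (M : lmodType R) (d : nat) : Prop :=
  is_largest (strict_chain (fun p : {pred R} =>
    prime_ideal p /\ {subset annihilator M <= p})) d.

Definition finite_length (V : lmodType R) : Prop :=
  exists n, forall k, strict_chain (@submod_closed R V) k -> (k <= n)%N.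

(* M / (s) M *)
Definition quot_seq (M : lmodType R) (s : seq R) : lmodType R :=
  quot_mod (@ideal_smul R M (ideal_gen s) predT).

Definition system_of_parameters (m : {pred R}) (M : lmodType R) (d : nat)
    (x : d.-tuple R) : Prop :=
  [/\ has_dim M d, {subset x <= m} & finite_length (quot_seq M x)].

Definition regular_sequence (M : lmodType R) (s : seq R) : Prop :=
  (forall k, (k < size s)%N ->
     forall u : quot_seq M (take k s), s`_k *: u = 0 -> u = 0) /\
  exists u : quot_seq M s, u <> 0.

Definition has_depth (m : {pred R}) (M : lmodType R) (n : nat) : Prop :=
  is_largest (fun k => exists s : seq R,
    [/\ size s = k, {subset s <= m} & regular_sequence M s]) n.

(* For M <> 0. *)
Definition cohen_macaulay (m : {pred R}) (M : lmodType R) : Prop :=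
  exists n, has_depth m M n /\ has_dim M n.

Section Completion.
Variables (m : {pred R}) (M : lmodType R).
Definition adic_sub (n : nat) : {pred M} := ideal_smul (ideal_pow m n) predT.
HB.instance Definition _ n :=
  GRing.isSubmodClosed.Build R M (adic_sub n) (gen_submod_closed _).
Lemma adic_subS n : {in adic_sub n.+1, forall v, (idfun : {linear M -> M}) v \in adic_sub n}.
Proof. by apply: ideal_smulS => //; exact: ideal_powS. Qed.

Definition adic_quot (n : nat) : lmodType R := quot_mod (adic_sub n).
Definition adic_trans (n : nat) : {linear adic_quot n.+1 -> adic_quot n} :=
  quot_mod_map (@adic_subS n).

Definition completion : lmodType R := inv_lim adic_trans.
End Completion.

Definition injective_module (E : lmodType R) : Prop :=
  forall (A B : lmodType R) (f : {linear A -> B}) (g : {linear A -> E}),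
    injective f -> exists h : {linear B -> E}, forall a, h (f a) = g a.

Record injective_resolution (M : lmodType R) := InjectiveResolution {
  res_obj :> nat -> lmodType R;
  res_diff : forall n, {linear res_obj n -> res_obj n.+1};
  res_aug : {linear M -> res_obj 0};
  res_injective : forall n, injective_module (res_obj n);
  res_aug_inj : injective res_aug;
  res_exact0 : forall v, res_diff 0 v = 0 <-> exists u, res_aug u = v;
  res_exactS : forall n v,
    res_diff n.+1 v = 0 <-> exists u, res_diff n u = v }.

(* Gamma_m(V), the elements annihilated by some power of m. *)
Definition torsion (m : {pred R}) (V : lmodType R) : {pred V} :=
  fun v => `[< exists n, forall a, a \in ideal_pow m n -> a *: v = 0 >].
Arguments torsion : clear implicits.
Lemma torsion_closed m V : submod_closed (torsion m V).
Proof.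
split; first by apply/asboolP; exists 0%N => a _; rewrite scaler0.
move=> a u v /asboolP[k uk] /asboolP[l vl]; apply/asboolP.
exists (maxn k l) => b bkl.
have bk := ideal_pow_le (leq_maxl k l) bkl.
have bl := ideal_pow_le (leq_maxr k l) bkl.
by rewrite scalerDr scalerA mulrC -scalerA uk // vl // scaler0 addr0.
Qed.
HB.instance Definition _ m V :=
  GRing.isSubmodClosed.Build R V (torsion m V) (torsion_closed m V).

Section LocalCohomology.
Variables (m : {pred R}) (M : lmodType R) (E : injective_resolution M).

(* Cocycles and coboundaries of the complex Gamma_m(E). *)
Definition lc_cocycle (n : nat) : {pred E n} :=
  fun v => (v \in torsion m (E n)) && (res_diff E n v == 0).
Lemma lc_cocycle_closed n : submod_closed (@lc_cocycle n).
Proof.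
split; first by rewrite unfold_in rpred0 linear0 eqxx.
move=> a u v /andP[uT /eqP du] /andP[vT /eqP dv].
by rewrite unfold_in rpredD ?rpredZ // linearP du dv scaler0 addr0 eqxx.
Qed.
HB.instance Definition _ n :=
  GRing.isSubmodClosed.Build R (E n) (@lc_cocycle n) (lc_cocycle_closed n).

Definition lc_coboundary (n : nat) : {pred E n} :=
  match n with
  | 0 => fun v => v == 0
  | k.+1 => fun v =>
      `[< exists u, u \in torsion m (E k) /\ res_diff E k u = v >]
  end.
Lemma lc_coboundary_closed n : submod_closed (@lc_coboundary n).
Proof.
case: n => [|n].
  split; first by rewrite unfold_in /= eqxx.
  by move=> a u v /eqP-> /eqP->; rewrite unfold_in /= scaler0 addr0 eqxx.
split; first by apply/asboolP; exists 0; rewrite rpred0 linear0.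
move=> a _ _ /asboolP[u [uT <-]] /asboolP[v [vT <-]]; apply/asboolP.
by exists (a *: u + v); rewrite rpredD ?rpredZ // linearP.
Qed.
HB.instance Definition _ n :=
  GRing.isSubmodClosed.Build R (E n) (@lc_coboundary n) (lc_coboundary_closed n).

(* H^j_m(M), the j-th right derived functor of Gamma_m at M, computed from E. *)
Definition local_cohomology (j : int) : lmodType R :=
  match j with
  | Posz n => subquot (@lc_cocycle n) (@lc_coboundary n)
  | Negz _ => zero_mod R
  end.
End LocalCohomology.

Section Koszul.
Variables (r : nat) (X : lmodType R).

(* The total Koszul module: f stands for the sum over S of e_S (x) f S, where
   e_S = e_{j_1} /\ ... /\ e_{j_p} for S = {j_1 < ... < j_p}. *)
Definition koszul : lmodType R := {ffun {set 'I_r} -> X}.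

Definition koszul_deg (p : int) (f : koszul) : Prop :=
  forall S : {set 'I_r}, f S <> 0 -> #|S|%:Z = p.

(* e_{j_1} /\ ... /\ e_{j_p} |-> sum_k (-1)^(k-1) a_{j_k} e_{j_1} /\ ..^.. /\ e_{j_p},
   read off at the coefficient of e_T. *)
Definition koszul_diff (a : 'I_r -> R) (f : koszul) : koszul :=
  [ffun T : {set 'I_r} => \sum_(j | j \notin T)
     ((-1) ^+ #|[set k in T | (k < j)%N]| * a j) *: f (j |: T)].

Lemma koszul_diff_linear a : linear (koszul_diff a).
Proof.
move=> c f g; apply/ffunP => T; rewrite !ffunE scaler_sumr -big_split /=.
apply: eq_bigr => j _; rewrite !ffunE scalerDr !scalerA; congr (_ *: _ + _).
by rewrite mulrC.
Qed.
HB.instance Definition _ a := GRing.isLinear.Build R koszul koszul *:%R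
  (koszul_diff a) (koszul_diff_linear a).

Definition koszul_scale (x : 'I_r -> R) (f : koszul) : koszul :=
  [ffun S : {set 'I_r} => (\prod_(j in S) x j) *: f S].

Lemma koszul_scale_linear x : linear (koszul_scale x).
Proof.
move=> c f g; apply/ffunP => T; rewrite !ffunE scalerDr !scalerA.
by congr (_ *: _ + _); rewrite mulrC.
Qed.
HB.instance Definition _ x := GRing.isLinear.Build R koszul koszul *:%R
  (koszul_scale x) (koszul_scale_linear x).

Lemma koszul_diff_scale (a b x : 'I_r -> R) f :
    (forall j, b j = a j * x j) ->
  koszul_diff a (koszul_scale x f) = koszul_scale x (koszul_diff b f).
Proof.
move=> bE; apply/ffunP => T; rewrite !ffunE scaler_sumr.
apply: eq_bigr => j jT; rewrite !ffunE !scalerA big_setU1 //= bE.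
by congr (_ *: _); rewrite [RHS]mulrC -!mulrA.
Qed.

Lemma koszul_deg_linear p c f g :
  koszul_deg p f -> koszul_deg p g -> koszul_deg p (c *: f + g).
Proof.
move=> fp gp S; rewrite !ffunE => nz.
have [fS0|/eqP] := eqVneq (f S) 0; last exact: fp.
by apply: gp => gS0; apply: nz; rewrite fS0 gS0 scaler0 addr0.
Qed.

Lemma koszul_deg0 p : koszul_deg p 0.
Proof. by move=> S; rewrite ffunE. Qed.

Lemma koszul_deg_scale p x f : koszul_deg p f -> koszul_deg p (koszul_scale x f).
Proof. by move=> fp S; rewrite ffunE => nz; apply: fp => f0; apply: nz; rewrite f0 scaler0. Qed.

Definition koszul_cycle (a : 'I_r -> R) (p : int) : {pred koszul} :=
  fun f => `[< koszul_deg p f /\ koszul_diff a f = 0 >].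
Lemma koszul_cycle_closed a p : submod_closed (koszul_cycle a p).
Proof.
split; first by apply/asboolP; split; [exact: koszul_deg0 | exact: linear0].
move=> c f g /asboolP[fp df] /asboolP[gp dg]; apply/asboolP; split.
  exact: koszul_deg_linear.
by rewrite linearP /= df dg scaler0 addr0.
Qed.
HB.instance Definition _ a p :=
  GRing.isSubmodClosed.Build R koszul (koszul_cycle a p) (koszul_cycle_closed a p).

Definition koszul_boundary (a : 'I_r -> R) (p : int) : {pred koszul} :=
  fun f => `[< exists g, koszul_deg (p + 1) g /\ koszul_diff a g = f >].
Lemma koszul_boundary_closed a p : submod_closed (koszul_boundary a p).
Proof.
split; first by apply/asboolP; exists 0; split; [exact: koszul_deg0 | exact: linear0].
move=> c _ _ /asboolP[f [fp <-]] /asboolP[g [gp <-]]; apply/asboolP.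
by exists (c *: f + g); split; [exact: koszul_deg_linear | exact: linearP].
Qed.
HB.instance Definition _ a p :=
  GRing.isSubmodClosed.Build R koszul (koszul_boundary a p) (koszul_boundary_closed a p).

Definition koszul_homology (a : 'I_r -> R) (p : int) : lmodType R :=
  subquot (koszul_cycle a p) (koszul_boundary a p).

Variable x : r.-tuple R.

Definition tuple_pow (n : nat) (j : 'I_r) : R := tnth x j ^+ n.

Lemma koszul_trans_cycle n p :
  {in koszul_cycle (tuple_pow n.+1) p, forall f,
     koszul_scale (tnth x) f \in koszul_cycle (tuple_pow n) p}.
Proof.
move=> f /asboolP[fp df]; apply/asboolP; split; first exact: koszul_deg_scale.
rewrite (@koszul_diff_scale _ (tuple_pow n.+1)) ?df ?linear0 // => j.
by rewrite /tuple_pow exprSr.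
Qed.

Lemma koszul_trans_boundary n p :
  {in koszul_boundary (tuple_pow n.+1) p, forall f,
     koszul_scale (tnth x) f \in koszul_boundary (tuple_pow n) p}.
Proof.
move=> _ /asboolP[g [gp <-]]; apply/asboolP; exists (koszul_scale (tnth x) g).
split; first exact: koszul_deg_scale.
by rewrite (@koszul_diff_scale _ (tuple_pow n.+1)) // => j; rewrite /tuple_pow exprSr.
Qed.

Definition koszul_trans (n : nat) (p : int) :
    {linear koszul_homology (tuple_pow n.+1) p -> koszul_homology (tuple_pow n) p} :=
  subquot_map (@koszul_trans_cycle n p) (@koszul_trans_boundary n p).

(* The limit is over the exponents n >= 1. *)
Definition local_homology (i : int) : lmodType R :=
  inv_lim (fun n => koszul_trans n.+1 i).
End Koszul.

End CommutativeAlgebra.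

(* Main.v *)
Require Import Defs.
From HB Require Import structures.
From mathcomp Require Import all_boot all_order all_algebra.
From mathcomp Require Import all_classical.
From mathcomp Require Import perm ring.

(** Everything is computed on the injective resolution [E] itself.

    Let [K n] be the Koszul complex of the [n]-th powers of the system of
    parameters on [E], built as an iterated mapping fibre of multiplications
    ([kos]). Its cohomology lives in degrees at most [d] and is
    [M / (x ^ n) M] in degree [d] ([kos_resolves_from]); it is [m]-torsion,
    because [m] is contained in the radical of [(x) + Ann M]
    ([parameters_ideal_pow], by the determinant trick). A bounded below complex
    of injective modules with torsion cohomology has the same cohomology as its
    torsion subcomplex: torsion submodules are direct summands of injective
    modules ([injective_torsion_retract]), and the quotient is a bounded below
    complex of torsion-free injective modules with torsion cohomology, which
    splits ([torsion_contraction]). So the torsion subcomplex of [K n] also has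
    [M / (x ^ n) M] as cohomology in degree [d], and none in higher degrees.

    That torsion subcomplex is the Koszul complex of the torsion part of [E], whose
    cohomology is [H_m(M)]. Multiplication by an element of [m] is locally
    nilpotent on [H_m(M)], so the vanishing of the cohomology of a fibre in some
    degree goes back to [E] ([torsion_exact_of_cone]). Applied to [x], this
    gives the vanishing of [H_m(M)] above [d]; applied to a regular sequence of
    length [d], whose Koszul complex is exact below [d], the vanishing below
    [d] ([regular_torsion_exact]). The exact sequences of the fibres then show
    that [x] is coregular on [X = H_m^d(M)] ([kos_coregular]) and that the
    submodule of [X] killed by the [x_j ^ n] is the cohomology of the torsion
    part of [K n] in degree [d], that is [M / (x ^ n) M] ([koszul_lift]).

    A coregular sequence has no Koszul homology outside of degree [d]
    ([koszul_coregular_exact]). In degree [d], multiplication by the product of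
    the [x_j] corresponds to the projection of [M / (x ^ n.+1) M] onto
    [M / (x ^ n) M] ([kos_change_power]), and the [(x ^ n) M] are cofinal with
    the [m ^ n M], so the limit is the completion ([completion_cofinal]). *)


Set Implicit Arguments.
Unset Strict Implicit.
Unset Printing Implicit Defensive.

Import GRing.Theory.
Local Open Scope ring_scope.

(** * Powers of ideals in a Noetherian local ring *)

Section Ideals.
Variable R : comNzRingType.
Implicit Types (I m : {pred R}) (s : seq R).

Definition ideal I := @submod_closed R R^o I.

Lemma ideal0 I : ideal I -> 0 \in I. Proof. by case. Qed.
Lemma idealD I a b : ideal I -> a \in I -> b \in I -> a + b \in I.
Proof. by case=> _ IC aI bI; rewrite -[a]mul1r; exact: IC. Qed.
Lemma idealM I a b : ideal I -> b \in I -> a * b \in I.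
Proof. by case=> I0 IC bI; rewrite -[a * b]addr0; exact: IC. Qed.

Lemma ideal_genP s : ideal (ideal_gen s).
Proof. exact: gen_submod_closed. Qed.

Lemma expr_ideal_pow I a n : a \in I -> a ^+ n \in ideal_pow I n.
Proof.
move=> aI; elim: n => [|n IHn] //=.
by apply: mem_gen_submod; apply/asboolP; exists a, (a ^+ n); rewrite exprS.
Qed.

Definition colon I a : {pred R} := fun b => a * b \in I.

Lemma colonP I a : ideal I -> ideal (colon I a).
Proof.
move=> IC; split=> [|b u v uI vI]; rewrite unfold_in ?mulr0 ?ideal0 //.
by rewrite mulrDr -[b *: u]/(b * u) mulrCA; apply: idealD => //; apply: idealM.
Qed.

(** By induction on a bound for the sum of the exponents: [m ^ n.+1] is spanned
    by products of a generator [a] with an element of [m ^ n], and the colon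
    ideal [I : a] contains a smaller power of [a] than [I]. *)
Lemma ideal_pow_sub_sum m s I (k : R -> nat) n :
    {subset m <= ideal_gen s} -> ideal I ->
    {in s, forall a, a ^+ k a \in I} -> (\sum_(a <- undup s) k a <= n)%N ->
  {subset ideal_pow m n.+1 <= I}.
Proof.
move=> ms; elim: n I k => [|n IHn] I k IC kI kn;
  apply: (@gen_submod_min R R^o) => // _ /asboolP[a [u [/ms aG uP ->]]];
  suff: a \in colon I u by [rewrite unfold_in mulrC];
  apply: (@gen_submod_min R R^o (mem s) _ (colonP u IC) _ a aG) => {aG}a sa;
  have [ka0|ka_gt0] := posnP (k a);
  try (by have := kI a sa; rewrite ka0 expr0 unfold_in => I1;
          rewrite -[_ * a]mulr1; exact: idealM);
  rewrite (bigD1_seq a) ?mem_undup ?undup_uniq //= in kn.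
  by move: kn; rewrite leqn0 addn_eq0 -leqn0 leqNgt ka_gt0.
rewrite unfold_in mulrC.
apply: (IHn (colon I a) (fun b => if b == a then (k a).-1 else k b)) uP.
- exact: colonP.
- move=> b sb; rewrite unfold_in; case: eqVneq => [->|_].
    by rewrite -exprS prednK // kI.
  by apply: idealM => //; exact: kI.
rewrite (bigD1_seq a) ?mem_undup ?undup_uniq //= eqxx.
rewrite (eq_bigr k) => [|b /negPf-> //].
by rewrite -ltnS -addSn prednK.
Qed.

Lemma ideal_pow_sub m s I :
    {subset m <= ideal_gen s} -> ideal I ->
    {in s, forall a, exists k, a ^+ k \in I} ->
  exists N, {subset ideal_pow m N <= I}.
Proof.
move=> ms IC kI.
have /choice[k kP] : forall a, exists k, a \in s -> a ^+ k \in I.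
  move=> a; case: (boolP (a \in s)) => [/kI[k kI']|_]; first by exists k.
  by exists 0%N.
exists (\sum_(a <- undup s) k a).+1.
exact: (ideal_pow_sub_sum ms IC kP).

Qed.

Hypothesis nR : noetherian R.

Lemma noetherian_acc (J : nat -> {pred R}) :
    (forall k, ideal (J k)) -> (forall k, {subset J k <= J k.+1}) ->
  exists k, forall l, {subset J l <= J k}.
Proof.
move=> JC JS.
have JL k l : (k <= l)%N -> {subset J k <= J l}.
  move=> /subnK <-; elim: (l - k)%N => // n IHn a /IHn; rewrite addSn; exact: JS.
pose U : {pred R} := fun a => `[< exists k, a \in J k >].
have [|s Us] := nR (I := U).
  split; first by apply/asboolP; exists 0%N; exact: ideal0.
  move=> a u v /asboolP[k uk] /asboolP[l vl]; apply/asboolP; exists (maxn k l).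
  by apply: idealD => //; [apply: idealM => // |]; 
    [apply: (JL k) => //; exact: leq_maxl | apply: (JL l) => //; exact: leq_maxr].
have [k sk] : exists k, {subset s <= J k}.
  have : {subset s <= U} by move=> a sa; rewrite Us; exact: mem_gen_submod.
  elim: {Us} s => [|a s IHs] sU; first by exists 0%N.
  have [|k sk] := IHs; first by move=> b sb; apply: sU; rewrite inE sb orbT.
  have /asboolP[l al] := sU a (mem_head _ _).
  exists (maxn k l) => b; rewrite inE => /predU1P[->|/sk].
    by apply: (JL l) => //; exact: leq_maxr.
  by apply: (JL k); exact: leq_maxl.
exists k => l a al.
have : a \in U by apply/asboolP; exists l.
by rewrite Us; exact: (@gen_submod_min R R^o (mem s) (J k) (JC k) sk).
Qed.

(** An ascending chain of proper ideals above [I] with no maximal member would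
    contradict the chain condition. *)
Lemma ex_maximal_ideal I : idealr_closed I ->
  exists m, maximal_ideal m /\ {subset I <= m}.
Proof.
move=> IP; apply: contrapT => noMax.
have step (J : {J : {pred R} | idealr_closed J /\ {subset I <= J}}) :
    {J' : {J : {pred R} | idealr_closed J /\ {subset I <= J}} |
       {subset sval J <= sval J'} /\ ~ {subset sval J' <= sval J}}.
  case: J => J [JP IJ] /=; apply: cid; apply: contrapT => nJ; apply: noMax.
  exists J; split=> //; split=> // J' J'P JJ' a; apply/idP/idP; last exact: JJ'.
  move=> aJ'; apply: contrapT => aJ; apply: nJ.
  have IJ' : {subset I <= J'} by move=> b /IJ /JJ'.
  by exists (exist _ J' (conj J'P IJ')); split=> //= /(_ a aJ').
pose J k := sval (iter k (fun J => sval (step J)) (exist _ I (conj IP (fun _ => id)))).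
have JP k : idealr_closed (J k).
  by rewrite /J; case: (iter _ _ _) => ? [].
have [k|k|k kP] := noetherian_acc (J := J).
- by case: (JP k) => J0 _ JC; split=> // a u v; exact: JC.
- by rewrite /J /=; case: (step _) => ? [].
have := kP k.+1; rewrite /J /=; case: (step _) => ? /= []; by [].
Qed.

Lemma local_unit m a : is_local m -> a \in m -> exists b, (1 - a) * b = 1.
Proof.
move=> [[[_ m1 mC] _] mU] am; apply: contrapT => nU.
pose I : {pred R} := fun c => `[< exists b, c = (1 - a) * b >].
have [|m' [m'max Im']] := ex_maximal_ideal (I := I).
  split; first by apply/asboolP; exists 0; rewrite mulr0.
    by apply/asboolP => -[b e]; apply: nU; exists b.
  move=> c u v /asboolP[b ->] /asboolP[b' ->]; apply/asboolP; exists (c * b + b').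
  by rewrite mulrDr mulrCA.
have : 1 - a \in m by rewrite -(mU _ m'max); apply: Im'; apply/asboolP; exists 1; rewrite mulr1.
move=> /(mC 1 _ _ am); rewrite mul1r addrC subrK; exact: (negP m1).
Qed.

End Ideals.

Section Determinants.
Variable R : comNzRingType.

Lemma det_cong (I : {pred R}) n (A B : 'M[R]_n) : ideal I ->
  (forall i j, A i j - B i j \in I) -> \det A - \det B \in I.
Proof.
move=> IC AB; rewrite /determinant -sumrB.
elim/big_ind: _ => [|a b|s _]; [exact: ideal0 | exact: idealD | ].
rewrite -mulrBr; apply: idealM => //.
elim/big_rec2: _ => [|i a b _ abI]; first by rewrite subrr ideal0.
have -> : A i (s i) * b - B i (s i) * a = A i (s i) * (b - a) + a * (A i (s i) - B i (s i)).
  by rewrite !mulrBr addrA [a * A _ _]mulrC subrK [a * B _ _]mulrC.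
by apply: idealD => //; apply: idealM.
Qed.

(** The determinant trick, by the adjugate matrix. *)
Lemma det_kills (M : lmodType R) n (A : 'M[R]_n) (e : 'I_n -> M) :
  (forall i, \sum_j A i j *: e j = 0) -> forall i, \det A *: e i = 0.
Proof.
move=> Ae i.
have -> : \det A *: e i = \sum_k (\adj A *m A) i k *: e k.
  rewrite mul_adj_mx (bigD1 i) //= !mxE eqxx mulr1n big1 ?addr0 // => k ki.
  by rewrite !mxE eq_sym (negPf ki) mulr0n scale0r.
under eq_bigr do rewrite mxE scaler_suml.
rewrite exchange_big big1 // => j _.
under eq_bigr do rewrite -scalerA.
by rewrite -scaler_sumr Ae scaler0.
Qed.

End Determinants.

(** * Systems of parameters *)

Section FiniteLength.
Variable R : comNzRingType.

Lemma ideal_gen1 (a c : R) : c \in ideal_gen [:: a] -> exists z, c = a * z.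
Proof.
pose J : {pred R} := fun c => `[< exists z, c = a * z >].
move=> ca; apply/asboolP; suff: c \in J by [].
apply: (@gen_submod_min R R^o (mem [:: a]) J _ _ c ca).
  split; first by apply/asboolP; exists 0; rewrite mulr0.
  move=> b _ _ /asboolP[z ->] /asboolP[z' ->]; apply/asboolP; exists (b * z + z').
  by rewrite mulrDr -[b *: _]/(b * _) mulrCA.
by move=> b; rewrite inE => /eqP->; apply/asboolP; exists 1; rewrite mulr1.
Qed.

Lemma gen_submod_coef (M : lmodType R) (e : seq M) (I : {pred R}) :
    gen_submod (mem e) =i predT -> ideal I ->
  forall v, v \in ideal_smul I (predT : {pred M}) ->
    exists c : 'I_(size e) -> R,
      (forall j, c j \in I) /\ v = \sum_j c j *: e`_j.
Proof.
move=> eM IC v vI.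
pose P (J : {pred R}) : {pred M} := fun v =>
  `[< exists c : 'I_(size e) -> R, (forall j, c j \in J) /\ v = \sum_j c j *: e`_j >].
have PC J : ideal J -> submod_closed (P J).
  move=> JC; split.
    apply/asboolP; exists (fun=> 0); split=> [j|]; first exact: ideal0.
    by rewrite big1 // => j _; rewrite scale0r.
  move=> a _ _ /asboolP[c [cJ ->]] /asboolP[c' [c'J ->]]; apply/asboolP.
  exists (fun j => a * c j + c' j); split=> [j|].
    by apply: idealD => //; exact: idealM.
  rewrite scaler_sumr -big_split; apply: eq_bigr => j _ /=.
  by rewrite scalerDl scalerA.
apply/asboolP; suff: v \in P I by [].
apply: (gen_submod_min (PC I IC)) vI => {}v /asboolP[a [u [aI _ ->]]].
have : u \in P predT.
  have : u \in gen_submod (mem e) by rewrite eM.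
  apply: gen_submod_min => {u}; first by apply: PC; split.
  move=> u ue; apply/asboolP.
  have ui : (index u e < size e)%N by rewrite index_mem.
  exists (fun j => (j == Ordinal ui)%:R); split=> //.
  rewrite (bigD1 (Ordinal ui)) //= eqxx scale1r nth_index // big1 ?addr0 //.
  by move=> j /negPf->; rewrite scale0r.
case/asboolP=> c [_ ->]; apply/asboolP; exists (fun j => a * c j); split=> [j|].
  by rewrite mulrC; exact: idealM.
by rewrite scaler_sumr; apply: eq_bigr => j _; rewrite scalerA.
Qed.

(** Otherwise the [a ^ i V] would form chains of submodules of any length. *)
Lemma finite_length_stable (V : lmodType R) (a : R) : finite_length V ->
  exists k, forall v : V, exists w : V, a ^+ k *: v = a ^+ k.+1 *: w.
Proof.
move=> [n nP]; apply: contrapT => nk.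
have {}nk k : exists v : V, forall w, a ^+ k *: v <> a ^+ k.+1 *: w.
  apply: contrapT => h; apply: nk; exists k => v; apply: contrapT => h'.
  by apply: h; exists v => w e; apply: h'; exists w.
suff : (n.+1 <= n)%N by rewrite ltnn.
apply: nP; exists (fun i v => `[< exists w, v = a ^+ (n.+1 - i) *: w >]).
split=> i iP.
  split; first by apply/asboolP; exists 0; rewrite scaler0.
  move=> c _ _ /asboolP[u ->] /asboolP[v ->]; apply/asboolP; exists (c *: u + v).
  by rewrite scalerDr !scalerA mulrC.
rewrite subSn // subSS; split.
  move=> _ /asboolP[w ->]; apply/asboolP; exists (a *: w).
  by rewrite scalerA exprSr.
have [v vP] := nk (n - i)%N; move=> /(_ (a ^+ (n - i) *: v)) sub.
have /sub/asboolP[w] : a ^+ (n - i) *: v \in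
    (fun v => `[< exists w, v = a ^+ (n - i) *: w >] : bool).
  by apply/asboolP; exists v.
exact: vP.
Qed.

(** A power [a ^ k M] agrees with [a ^ k.+1 M] modulo [(x) M], which gives a matrix
    congruent to [a ^ k (1 - a C)] modulo [(x)] that kills generators of [M].  Its
    determinant annihilates [M]; modulo [(x)], it is a power of [a] times
    [det (1 - a C)], a unit since the ring is local. *)
Lemma nilpotent_mod_annihilator (m : {pred R}) (M : lmodType R) (x : seq R) (a : R) :
    noetherian R -> is_local m -> finitely_generated M ->
    finite_length (quot_seq M x) -> a \in m ->
  exists t b, b \in annihilator M /\ a ^+ t - b \in ideal_gen x.
Proof.
move=> nR lR [e eM] fl am.
have [k kP] := finite_length_stable a fl.
have IC := @ideal_genP R x.
set N := ideal_smul (ideal_gen x) (predT : {pred M}).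
have /choice[C CP] : forall i : 'I_(size e), exists C : 'I_(size e) -> R,
    a ^+ k *: e`_i - a ^+ k.+1 *: (\sum_j C j *: e`_j) \in N.
  move=> i; have [w] := kP (quot_pi _ e`_i).
  rewrite -[w]quot_reprK -!linearZ => /eqP; rewrite quot_piE.
  have [||C [_ ->]] := gen_submod_coef eM (I := predT) _ (v := quot_repr w).
  - by split.
  - apply: mem_gen_submod; apply/asboolP; exists 1, (quot_repr w).
    by rewrite scale1r.
  by exists C.
have /choice[X XP] := fun i => gen_submod_coef eM IC (CP i).
pose A0 : 'M[R]_(size e) := \matrix_(i, j) ((i == j)%:R - a * C i j).
pose A := \matrix_(i, j) (a ^+ k * A0 i j - X i j).
have detA (i : 'I_(size e)) : \det A *: e`_i = 0.
  apply: (@det_kills R M _ A (fun i : 'I_(size e) => e`_i) _ i) => {}i.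
  have [_ eX] := XP i.
  under eq_bigr do rewrite mxE scalerBl mxE mulrBr scalerBl.
  rewrite !sumrB -eX (bigD1 i) //= eqxx mulr1 big1 => [|j /negPf ji]; last first.
    by rewrite eq_sym ji mulr0 scale0r.
  rewrite addr0 scaler_sumr [X in _ - X - _](_ : _ = \sum_j a ^+ k.+1 *: (C i j *: e`_j)).
    by rewrite subrr.
  by apply: eq_bigr => j _; rewrite scalerA exprSr !mulrA.
have [z zP] : exists z, 1 - \det A0 = a * z.
  apply: ideal_gen1; rewrite -(det1 R (size e)).
  apply: det_cong => [|i j]; first exact: ideal_genP.
  rewrite !mxE opprB addrC subrK mulrC; apply: idealM; first exact: ideal_genP.
  by apply: mem_gen_submod; rewrite mem_head.
have [u uP] := local_unit (a := a * z) nR lR ltac:(by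
  rewrite mulrC; case: (lR) => [[[m0 _ mC] _] _]; rewrite -[z * a]addr0; exact: mC).
have {zP} eA0 : \det A0 * u = 1.
  by rewrite -uP -zP opprB addrC subrK.
exists (k * size e)%N, (u * \det A); split.
  apply/asboolP => v.
  have : v \in gen_submod (mem e) by rewrite eM.
  pose K : {pred M} := fun v => (u * \det A) *: v == 0.
  move=> vG; apply/eqP; suff: v \in K by [].
  apply: (@gen_submod_min R M (mem e)) vG => {v}.
    split=> [|c v w /eqP vK /eqP wK]; rewrite unfold_in ?scaler0 //.
    by rewrite scalerDr wK addr0 scalerA mulrC -scalerA vK scaler0.
  move=> v /(nthP 0)[i ie <-]; rewrite unfold_in -scalerA.
  by rewrite (detA (Ordinal ie)) scaler0.
have -> : a ^+ (k * size e) = u * \det (a ^+ k *: A0).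
  by rewrite detZ -exprM mulrCA [u * _]mulrC eA0 mulr1.
rewrite -mulrBr; apply: idealM => //; apply: det_cong => // i j.
by rewrite !mxE opprB addrC subrK; have [] := XP i.
Qed.

(** Together, the entries of [x] and the annihilator of [M] generate an ideal whose
    radical contains [m]. *)
Lemma parameters_ideal_pow (m : {pred R}) (M : lmodType R) (x : seq R) (I : {pred R}) :
    noetherian R -> is_local m -> finitely_generated M ->
    finite_length (quot_seq M x) -> ideal I ->
    {in x, forall a, exists k, a ^+ k \in I} ->
    {in annihilator M, forall b, exists k, b ^+ k \in I} ->
  exists N, {subset ideal_pow m N <= I}.
Proof.
move=> nR lR fg fl IC xI bI.
have [s sm] : exists s, m =i ideal_gen s.
  by apply: nR; case: (lR) => [[[m0 _ mC] _] _]; split=> // a u v; exact: mC.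
apply: (ideal_pow_sub (s := s)) => // [a|a sa]; first by rewrite sm.
have am : a \in m by rewrite sm; exact: mem_gen_submod.
have [t [b [bM ab]]] := nilpotent_mod_annihilator nR lR fg fl am.
have [|c|N NP] := ideal_pow_sub (m := ideal_gen (b :: x)) (s := b :: x) _ IC.
- by [].
- by rewrite inE => /predU1P[->|]; [exact: bI | exact: xI].
exists (t * N)%N; apply: NP; rewrite exprM; apply: expr_ideal_pow.
rewrite -(subrK b (a ^+ t)); apply: idealD; first exact: ideal_genP.
  apply: (@gen_submod_min R R^o (mem x)) ab; first exact: ideal_genP.
  by move=> c cx; apply: mem_gen_submod; rewrite inE cx orbT.
by apply: mem_gen_submod; rewrite mem_head.
Qed.

End FiniteLength.

(** * Torsion and injective modules *)

Section Torsion.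
Variables (R : comNzRingType) (m : {pred R}).
Implicit Types V W : lmodType R.
Local Notation Gamma := (torsion m (V := _)).

Lemma torsionP V (v : V) :
  reflect (exists n, forall a, a \in ideal_pow m n -> a *: v = 0) (v \in Gamma).
Proof. exact: asboolP. Qed.

Lemma torsion_linear V W (f : {linear V -> W}) v :
  v \in Gamma -> f v \in Gamma.
Proof.
move=> /torsionP[n vn]; apply/torsionP; exists n => a /vn av.
by rewrite -linearZ av linear0.
Qed.

Lemma torsion_pair V W (v : V * W) :
  (v \in Gamma) = (v.1 \in Gamma) && (v.2 \in Gamma).
Proof.
apply/idP/andP => [vT|[/torsionP[k vk] /torsionP[l vl]]].
  split; first by have := torsion_linear (fst : {linear (V * W)%type -> V}) vT.
  by have := torsion_linear (snd : {linear (V * W)%type -> W}) vT.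
apply/torsionP; exists (maxn k l) => a akl; rewrite [v]surjective_pairing.
congr pair; [apply: vk | apply: vl].
  by apply: ideal_pow_le akl; exact: leq_maxl.
by apply: ideal_pow_le akl; exact: leq_maxr.
Qed.

Lemma torsion_expr V (v : V) a : a \in m -> v \in Gamma ->
  exists k, a ^+ k *: v = 0.
Proof.
by move=> am /torsionP[k vk]; exists k; apply: vk; exact: expr_ideal_pow.
Qed.

Definition submod_colon V (N : {pred V}) (v : V) : {pred R} := fun c => c *: v \in N.

Lemma submod_colonP V (N : {pred V}) v : submod_closed N -> ideal (submod_colon N v).
Proof.
move=> [N0 NC]; split=> [|a b c bN cN]; first by rewrite unfold_in scale0r.
by rewrite unfold_in scalerDl -scalerA; exact: NC.
Qed.

Lemma submod0P V : submod_closed (pred1 (0 : V)).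
Proof.
by split=> [|a u v]; rewrite !inE // => /eqP-> /eqP->; rewrite scaler0 addr0.
Qed.

Hypothesis nR : noetherian R.
Hypothesis mI : ideal m.

Lemma ideal_pow_noetherian I : ideal I ->
    {in m, forall a, exists k, a ^+ k \in I} ->
  exists N, {subset ideal_pow m N <= I}.
Proof.
have [s sm] := nR mI; move=> IC mkI.
apply: (ideal_pow_sub (s := s)) => // [a|a sa]; first by rewrite sm.
by apply: mkI; rewrite sm; exact: mem_gen_submod.
Qed.

Lemma torsion_nilpotent V (v : V) :
  {in m, forall a, exists k, a ^+ k *: v \in Gamma} -> v \in Gamma.
Proof.
move=> mv; have [a am|N NP] := ideal_pow_noetherian (submod_colonP v (@submod0P V)).
  have [k /(torsion_expr am)[l lv]] := mv a am.
  by exists (l + k)%N; rewrite unfold_in inE exprD -scalerA lv.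
by apply/torsionP; exists N => a /NP; rewrite unfold_in inE => /eqP.
Qed.

End Torsion.

Section Injective.
Variable R : comNzRingType.
Implicit Types V W E : lmodType R.

(** Turns a proof of closure into the bundled structure that [sub_mod] expects. *)
Definition submodClosed_of V (N : {pred V}) (NC : submod_closed N) : submodClosed V :=
  HB.pack N (GRing.isSubmodClosed.Build R V N NC).

Definition linear_relation V W (Rel : V -> W -> Prop) : Prop :=
  Rel 0 0 /\ forall a u v u' v', Rel u v -> Rel u' v' -> Rel (a *: u + u') (a *: v + v').

(** Injectivity applied to the first projection of the graph of the relation. *)
Lemma injective_extension V E (Rel : V -> E -> Prop) :
    injective_module E -> linear_relation Rel -> (forall w, Rel 0 w -> w = 0) ->
  exists h : {linear V -> E}, forall v w, Rel v w -> h v = w.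
Proof.
move=> injE [Rel0 RelC] Relf.
pose G : {pred (V * E)%type} := fun p => `[< Rel p.1 p.2 >].
have GC : submod_closed G.
  split; first exact/asboolP.
  by move=> a [u v] [u' v'] /asboolP uv /asboolP uv'; apply/asboolP; exact: RelC.
pose N := submodClosed_of GC.
pose incl : {linear sub_mod N -> (V * E)%type} := val.
pose f : {linear sub_mod N -> V} := (fst : {linear (V * E)%type -> V}) \o incl.
pose g : {linear sub_mod N -> E} := (snd : {linear (V * E)%type -> E}) \o incl.
have [|h hP] := injE _ _ f g.
  move=> p q fpq; apply: val_inj.
  have /asboolP : - 1 *: val p + val q \in G by apply: (proj2 GC); exact: valP.
  move: fpq; rewrite /f /=.
  case: (val p) (val q) => [u v] [_ v'] /= <- {}.
  by rewrite !scaleN1r addNr => /Relf/addr0_eq; rewrite opprK => ->.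
exists h => v w vw.
have pG : (v, w) \in G by exact/asboolP.
exact: (hP (SubMod (N := N) pG)).
Qed.

Lemma linear_of_relation V W (Rel : V -> W -> Prop) :
    linear_relation Rel -> (forall w, Rel 0 w -> w = 0) -> (forall v, exists w, Rel v w) ->
  exists h : {linear V -> W}, forall v, Rel v (h v).
Proof.
move=> [Rel0 RelC] Relf /choice[h hP].
have hL : linear h.
  move=> a u v; have := RelC (- 1) _ _ _ _ (RelC a _ _ _ _ (hP u) (hP v)) (hP (a *: u + v)).
  by rewrite !scaleN1r addNr => /Relf/addr0_eq; rewrite opprK => ->.
pose hh : {linear V -> W} := HB.pack h (GRing.isLinear.Build R V W *:%R h hL).
by exists hh.
Qed.

Lemma injective_pair E E' :
  injective_module E -> injective_module E' -> injective_module (E * E')%type.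
Proof.
move=> iE iE' A B f g finj.
have [h hP] := iE A B f ((fst : {linear (E * E')%type -> E}) \o g) finj.
have [h' hP'] := iE' A B f ((snd : {linear (E * E')%type -> E'}) \o g) finj.
pose k b : (E * E')%type := (h b, h' b).
have kL : linear k by move=> a u v; rewrite /k !linearP.
pose kk : {linear B -> (E * E')%type} := HB.pack k (GRing.isLinear.Build R _ _ *:%R k kL).
by exists kk => a /=; rewrite /k hP hP' -surjective_pairing.
Qed.

Lemma injective_trivial E : (forall v : E, v = 0) -> injective_module E.
Proof.
by move=> E0 A B f g _; exists \0 => a; rewrite (E0 (g a)).
Qed.

(** [W] is maximal among the submodules meeting [G] in 0, so that the image of [G]
    modulo [W] is essential. *)
Lemma essential_complement V (G : {pred V}) : submod_closed G ->
  exists W : {pred V}, [/\ submod_closed W,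
    (forall v, v \in G -> v \in W -> v = 0) &
    (forall v, v \notin W -> exists c w, [/\ w \in W, w + c *: v \in G & w + c *: v <> 0])].
Proof.
move=> [G0 GC].
pose P : set (set V) := fun W : set V =>
  (forall a u v, W u -> W v -> W (a *: u + v)) /\ (forall v, v \in G -> W v -> v = 0).
(* The empty set satisfies [P], as an empty chain demands, so that a maximal
   element is completed with 0. *)
have [F FP Ftot|A [[AC AG] Amax]] := Zorn_bigcup (P := P).
  split=> [a u v [X FX Xu] [Y FY Yv]|v vG [X FX Xv]]; last first.
    by have [_ XG] := FP _ FX; exact: XG.
  have [XY|YX] := Ftot _ _ FX FY.
    by exists Y => //; have [YC _] := FP _ FY; apply: YC => //; exact: XY.
  by exists X => //; have [XC _] := FP _ FX; apply: XC => //; exact: YX.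
have WC a u v : A u \/ u = 0 -> A v \/ v = 0 -> A (a *: u + v) \/ a *: u + v = 0.
  case=> [Au|->] [Av|->]; rewrite ?scaler0 ?add0r; [left; exact: AC| |by left|by right].
  left; have A0 : A 0 by have := AC (- 1) u u Au Au; rewrite scaleN1r addNr.
  exact: AC.
exists (fun v => `[< A v \/ v = 0 >]); split.
- split; first by apply/asboolP; right.
  by move=> a u v /asboolP Wu /asboolP Wv; apply/asboolP; exact: WC.
- by move=> v vG /asboolP[/(AG _ vG)|].
move=> v /asboolP vA; apply: contrapT => nv.
pose B : set V := fun u => exists c w, (A w \/ w = 0) /\ u = w + c *: v.
apply: (Amax B).
  split=> [u Au|BA]; first by exists 0, u; rewrite scale0r addr0; split=> //; left.
  apply: vA; left; apply: BA; exists 1, 0; rewrite add0r scale1r; split=> //.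
  by right.
split=> [a _ _ [c [w [Ww ->]]] [c' [w' [Ww' ->]]]|u uG [c [w [Ww eu]]]].
  exists (a * c + c'), (a *: w + w'); split; first exact: WC.
  by rewrite scalerDr addrACA scalerA -scalerDl.
apply: contrapT => u0; apply: nv; exists c, w; split; [exact/asboolP | | ].
  by rewrite -eu.
by rewrite -eu.
Qed.

Variable m : {pred R}.
Local Notation Gamma := (torsion m (V := _)).
Hypothesis nR : noetherian R.
Hypothesis mI : ideal m.

(** Let [W] be maximal with zero intersection with the torsion submodule.  Every
    [v] is torsion modulo [W]: for [a] in [m], the annihilators of the [a ^ l v]
    modulo [W] stabilize, while a multiple of [a ^ k v] is nonzero and killed by
    a power of [a] modulo [W] as long as [a ^ k v] is not in [W].  So a map
    which kills [W] has torsion values, and injectivity provides one which is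
    the identity on the torsion submodule. *)
Lemma injective_torsion_retract E : injective_module E ->
  exists r : {linear E -> E},
    (forall v, r v \in Gamma) /\ (forall v, v \in Gamma -> r v = v).
Proof.
move=> injE; have TC := torsion_closed m E.
have [W [WC WT Wess]] := essential_complement TC; have [W0 WD] := WC.
have modW v : exists N, forall c, c \in ideal_pow m N -> c *: v \in W.
  apply: (ideal_pow_noetherian nR mI (submod_colonP v WC)) => a am.
  have [|l b|k kP] := noetherian_acc nR (J := fun l => submod_colon W (a ^+ l *: v)).
  - by move=> l; exact: submod_colonP.
  - move=> blW; rewrite unfold_in exprS -scalerA scalerA mulrC -scalerA.
    by rewrite -[X in X \in W]addr0; exact: WD.
  exists k; rewrite unfold_in; apply: contrapT => /negP/Wess[c [w [wW wT]]].
  case; have [n] := torsion_expr am wT.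
  rewrite scalerDr => e; apply: WT => //.
  have : c \in submod_colon W (a ^+ k *: v).
    apply: (kP (n + k)%N); rewrite unfold_in.
    have -> : c *: (a ^+ (n + k) *: v) = - a ^+ n *: w + 0.
      rewrite addr0 scaleNr; apply/eqP; rewrite -addr_eq0 addrC -e exprD.
      by rewrite !scalerA mulrCA mulrA.
    exact: WD.
  by rewrite unfold_in addrC => cW; rewrite -[c *: _]scale1r; exact: WD.
pose Rel (v g : E) := g \in Gamma /\ v - g \in W.
have [||r rP] := injective_extension (Rel := Rel) injE.
- split; first by split; rewrite ?subr0 // rpred0.
  move=> a u v u' v' [vT uvW] [v'T uvW']; split; first by rewrite rpredD // rpredZ.
  by rewrite opprD addrACA -scalerBr; exact: WD.
- move=> g [gT]; rewrite sub0r => gW; apply: WT => //.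
  by rewrite -[g]opprK -scaleN1r -[_ *: _]addr0; exact: WD.
exists r; split=> v; last by move=> vT; apply: rP; split; rewrite ?subrr.
have [N NP] := modW v; apply/torsionP; exists N => c /NP cvW.
by rewrite -linearZ; apply: rP; split; rewrite ?subr0 // rpred0.
Qed.

End Injective.

(** * Complexes and their torsion subcomplexes *)

Section Complexes.
Variable R : comNzRingType.

(** Cochain complexes indexed by the natural numbers with a zero term in degree 0;
    the terms of a resolution are placed in degrees at least 1, so that no
    statement about cohomology has to treat its first degree separately. *)
Record complex := Complex {
  cx_obj :> nat -> lmodType R;
  cx_diff : forall n, {linear cx_obj n -> cx_obj n.+1};
  cx_diffK : forall n v, cx_diff n.+1 (cx_diff n v) = 0;
  cx_obj0 : forall v : cx_obj 0, v = 0 }.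
Arguments cx_diff {c n}.
Implicit Types T K : complex.
Local Notation d := (cx_diff).

(** The differential arriving in degree [n]; indexing it by its target gives the
    fibres below a uniform definition. *)
Definition cx_prev T n : T n.-1 -> T n :=
  match n with 0 => fun=> 0 | k.+1 => @cx_diff T k end.
Lemma cx_prev_linear T n : linear (@cx_prev T n).
Proof. by case: n => [|n] a u v /=; rewrite ?scaler0 ?addr0 // linearP. Qed.
HB.instance Definition _ T n := GRing.isLinear.Build R (T n.-1) (T n) *:%R
  (@cx_prev T n) (@cx_prev_linear T n).

Lemma cx_prevK T n v : d (@cx_prev T n v) = 0.
Proof. by case: n v => [|n] v /=; [rewrite linear0 | rewrite cx_diffK]. Qed.

Section Cone.
Variables (a : R) (T : complex).
Definition cone_obj n : lmodType R := (T n * T n.-1)%type.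
Definition cone_diff n (p : cone_obj n) : cone_obj n.+1 :=
  (d p.1, a *: p.1 - cx_prev p.2).
Lemma cone_diff_linear n : linear (@cone_diff n).
Proof.
move=> b [u v] [u' v']; congr pair; first exact: linearP.
by rewrite /= [cx_prev _]linearP scalerDr opprD addrACA scalerBr !scalerA mulrC.
Qed.
HB.instance Definition _ n := GRing.isLinear.Build R (cone_obj n) (cone_obj n.+1) *:%R
  (@cone_diff n) (@cone_diff_linear n).
Lemma cone_diffK n p : cone_diff (@cone_diff n p) = 0.
Proof.
rewrite /cone_diff /= cx_diffK; congr pair.
by rewrite linearB linearZ /= cx_prevK subr0 subrr.
Qed.
Lemma cone_obj0 (p : cone_obj 0) : p = 0.
Proof. by case: p => u v; rewrite (cx_obj0 u) (cx_obj0 v). Qed.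

(** The mapping fibre of multiplication by [a]: its cohomology in degree [n] is an
    extension of the kernel of [a] on the cohomology of [T] in degree [n] by the
    cokernel of [a] on that in degree [n - 1]. *)
Definition cone := Complex cone_diffK cone_obj0.
End Cone.

Section TorsionContraction.
Variable m : {pred R}.
Local Notation Gamma := (torsion m (V := _)).
Hypothesis nR : noetherian R.
Hypothesis mI : ideal m.

Definition nilpotent_at T n (a : R) :=
  forall v : T n.+1, d v = 0 -> exists k u, d u = a ^+ k *: v.

(** Let [Q] be the quotient of [K] by its torsion, a bounded below complex of
    injective modules without torsion.  If the cohomology of [K] is torsion in
    degrees up to [n], then [Q] is split exact there, and [h] lifts a
    contraction.  In the induction, [p] stands for a projection of [Q] with the
    cocycles as kernel. *)
Lemma torsion_contraction K n : (forall k, injective_module (K k)) ->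
    (forall k, (k <= n)%N -> {in m, forall a, nilpotent_at K k a}) ->
  exists h : {linear K n.+1 -> K n},
    forall v : K n.+1, d v \in Gamma -> v - d (h v) \in Gamma.
Proof.
move=> injK nilK.
have step k (p : {linear K k -> K k}) : {in m, forall a, nilpotent_at K k a} ->
    (forall u, d (u - p u) \in Gamma) -> (forall u, d u \in Gamma -> p u = 0) ->
    exists h : {linear K k.+1 -> K k},
      forall v : K k.+1, d v \in Gamma -> v - d (h v) \in Gamma.
  move=> nilk pd pZ.
  pose Rel (v : K k.+1) (w : K k) := exists u : K k, v - d u \in Gamma /\ w = p u.
  have [||h hP] := injective_extension (Rel := Rel) (injK k).
  - split; first by exists 0; rewrite [d 0]linear0 [p 0]linear0 subr0 rpred0.
    move=> a u v u' v' [w [wT ->]] [w' [wT' ->]]; exists (a *: w + w').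
    rewrite [d _]linearP [p (_ + _)]linearP; split=> //.
    by rewrite opprD addrACA -scalerBr rpredD // rpredZ.
  - by move=> w [u [uT ->]]; apply: pZ; rewrite -[d u]opprK rpredN -sub0r.
  exists h => v dvT; apply: (torsion_nilpotent nR mI) => a am.
  have [j jv] := torsion_expr am dvT.
  have [|i [u du]] := nilk a am (a ^+ j *: v); first by rewrite linearZ.
  exists (i + j)%N; rewrite exprD -scalerA scalerBr scalerBr.
  rewrite -[_ *: d (h v)]linearZ -[_ *: d _]linearZ -[_ *: h v]linearZ.
  rewrite -[_ *: h _]linearZ -du (hP (d u) (p u)); first by rewrite -linearB.
  by exists u; rewrite subrr rpred0.
have [p [pd pZ]] : exists p : {linear K n -> K n},
    (forall u, d (u - p u) \in Gamma) /\ (forall u, d u \in Gamma -> p u = 0).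
  elim: n nilK => [|n IHn] nilK.
    exists \0; split=> // u; by rewrite (cx_obj0 (u - _)) linear0 rpred0.
  have [|p [pd pZ]] := IHn; first by move=> k kn; apply: nilK; exact: leqW.
  have [h hP] := step n p (nilK n (leqnSn n)) pd pZ.
  have [r [rT rid]] := injective_torsion_retract nR mI (injK n.+1).
  pose q : {linear K n.+1 -> K n.+1} := idfun \- (d \o h).
  exists (q \- (r \o q)); split=> u /=.
    rewrite opprB addrC -addrA [- _ + u]addrC opprB subrKC linearD cx_diffK addr0.
    by rewrite torsion_linear.
  by move=> /hP duT; rewrite rid ?subrr.
exact: (step n p (nilK n (leqnn n)) pd pZ).
Qed.

End TorsionContraction.
End Complexes.

(** * Cohomology of the fibre of a multiplication *)

Arguments cx_diff {R c n}.

Section ConeCohomology.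
Local Notation d := cx_diff.
Variable R : comNzRingType.
Implicit Types T K : complex R.

Definition exact_at T n := forall v : T n.+1, d v = 0 -> exists u, d u = v.

Lemma cone_diffE a T n (u : T n.+1) (v : T n) :
  d ((u, v) : cone a T n.+1) = (d u, a *: u - d v) :> cone a T n.+2.
Proof. by []. Qed.

Lemma cone_cocycle a T n (u : T n.+1) (v : T n) :
  d ((u, v) : cone a T n.+1) = 0 <-> d u = 0 /\ a *: u = d v.
Proof.
rewrite cone_diffE; split; first by case=> -> /subr0_eq ->.
by case=> -> ->; rewrite subrr.
Qed.

(** Once [u] is a boundary, [v] is corrected by exactness of [T] one degree below. *)
Lemma cone_coboundary a T n (u : T n.+1) (v : T n) :
    (forall k, n = k.+1 -> exact_at T k) -> a *: u = d v -> (exists u', d u' = u) ->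
  exists p : cone a T n, d p = (u, v) :> cone a T n.+1.
Proof.
move=> exT auv [u' uE].
have : d (a *: u' - v) = 0 by rewrite linearB linearZ /= uE auv subrr.
case: n exT u v auv u' uE => [|n] exT u v auv u' uE.
  by exists 0; rewrite -uE (cx_obj0 u') (cx_obj0 v) !linear0.
move=> /(exT n erefl)[t tE]; exists (u', t).
by rewrite cone_diffE uE tE subKr.
Qed.

Section Resolves.
Variable M : lmodType R.

(** In degrees at least [c], [T] looks like a resolution of [M / N] placed in degree
    [c]. The quotient is not formed: [N] grows with each further fibre, while
    [M] stays. *)
Definition resolves_from T c (e : {linear M -> T c.+1}) (N : M -> Prop) :=
  [/\ forall w, d (e w) = 0,
      forall v, d v = 0 -> exists w u, v = e w + d u,
      forall w, N w <-> exists u, d u = e w &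
      forall n, (c < n)%N -> exact_at T n].

Definition cone_in a T n (v : T n) : cone a T n.+1 := (0, v).
Lemma cone_in_linear a T n : linear (@cone_in a T n).
Proof. by move=> b u v; congr pair; rewrite /= scaler0 addr0. Qed.
HB.instance Definition _ a T n := GRing.isLinear.Build R (T n) (cone a T n.+1) *:%R
  (@cone_in a T n) (@cone_in_linear a T n).

Definition add_multiples (a : R) (N : M -> Prop) w := exists w', N (w - a *: w').

Lemma cone_resolves_from a T c e N : @resolves_from T c e N ->
  @resolves_from (cone a T) c.+1 (@cone_in a T c.+1 \o e) (add_multiples a N).
Proof.
case=> ecyc egen eN exT; split=> [w|[u v]|w|n].
- by apply/cone_cocycle; rewrite ecyc linear0 scaler0.
- case/cone_cocycle=> du auv; have [u' uE] := exT c.+1 (ltnSn c) u du.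
  have [|w [t tE]] := egen (v - a *: u'); first by rewrite linearB linearZ /= uE auv subrr.
  exists w, (u', - t); rewrite cone_diffE; congr pair; first by rewrite add0r.
  by rewrite linearN opprK addrCA -tE addrC subrK.
- split=> [[w' /eN[t tE]]|[[u v]]].
    exists (e w', - t); rewrite cone_diffE ecyc linearN opprK tE.
    by rewrite linearB linearZ addrC subrK.
  case=> /egen[w' [t ->]] /= ewE; exists w'; apply/eN; exists (a *: t - v).
  rewrite [LHS]linearB [RHS]linearB !linearZ /= -ewE scalerDr.
  by rewrite [RHS]addrC scalerN !addrA addNr add0r.
case: n => // n cn [u v] /cone_cocycle[du auv].
apply: cone_coboundary => //; last by apply: exT du; exact: ltnW.
by move=> k [<-]; exact: exT.
Qed.

(** Regularity of [a] on [M / N] excludes the only cohomology that the fibre could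
    have in degree [c], the kernel of [a] on [M / N]. *)
Lemma cone_exact_below a T c e N : @resolves_from T c e N ->
    (forall w, N (a *: w) -> N w) ->
    (forall n, (n < c)%N -> exact_at T n) ->
  forall n, (n < c.+1)%N -> exact_at (cone a T) n.
Proof.
case=> ecyc egen eN _ regN exT n nc [u v] /cone_cocycle[du auv].
apply: cone_coboundary => //; first by move=> k nk; apply: exT; rewrite -nk.
move: nc; rewrite ltnS leq_eqVlt => /predU1P[nc|]; last by move/exT/(_ u du).
case: c / nc e ecyc egen eN exT => e ecyc egen eN exT.
have [w [t uE]] := egen u du.
have /regN/eN[t' tE'] : N (a *: w).
  apply/eN; exists (v - a *: t); rewrite [LHS]linearB [d (_ *: _)]linearZ [RHS]linearZ /= -auv uE.
  by rewrite scalerDr addrK.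
by exists (t' + t); rewrite linearD tE' uE.
Qed.

End Resolves.

(** Cohomology of the fibre is an extension of two modules on which [b] is
    nilpotent, hence the sum of two exponents. *)
Lemma cone_nilpotent a b T : (forall n, nilpotent_at T n b) ->
  forall n, nilpotent_at (cone a T) n b.
Proof.
move=> nilT n [u v] /cone_cocycle[du auv].
have [i [u' uE]] := nilT n u du.
have dw : d (b ^+ i *: v - a *: u') = 0.
  rewrite linearB [d (_ *: v)]linearZ [d (_ *: u')]linearZ /= uE -auv !scalerA.
  by rewrite mulrC subrr.
have [j [t tE]] : exists j (t : T n.-1), cx_prev t = b ^+ j *: (b ^+ i *: v - a *: u').
  move: dw; clear uE; clear auv du; case: n u v u' => [|n] u v u' dw.
    by exists 0%N, 0; rewrite expr0 scale1r; exact: esym (cx_obj0 _).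
  by have [j [t tE]] := nilT n _ dw; exists j, t.
exists (j + i)%N, (b ^+ j *: u', - t); congr pair.
  by rewrite linearZ /= uE scalerA exprD.
rewrite linearN opprK /= tE scalerBr addrC !scalerA exprD.
by rewrite [b ^+ j * a]mulrC subrK.
Qed.

(** Multiplication by [a] is homotopic to 0 on the fibre of [a]. *)
Lemma cone_nilpotent_self b i T n : nilpotent_at (cone (b ^+ i) T) n b.
Proof.
move=> [u v] /cone_cocycle[du auv]; exists i, (v, 0).
by congr pair; rewrite /= ?auv // linear0 subr0.
Qed.

Section TorsionCohomology.
Variable m : {pred R}.
Local Notation Gamma := (torsion m (V := _)).

Definition torsion_exact_at T n :=
  forall v : T n.+1, v \in Gamma -> d v = 0 -> exists2 u, u \in Gamma & d u = v.

Lemma cone_torsion_coboundary a T n (u : T n.+1) (v : T n) :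
    (forall k, n = k.+1 -> torsion_exact_at T k) -> v \in Gamma -> a *: u = d v ->
    (exists2 u', u' \in Gamma & d u' = u) ->
  exists2 p : cone a T n, p \in Gamma & d p = (u, v) :> cone a T n.+1.
Proof.
move=> exT vG auv [u' uG uE].
have : d (a *: u' - v) = 0 by rewrite linearB linearZ /= uE auv subrr.
have : a *: u' - v \in Gamma by rewrite rpredB // rpredZ.
case: n exT u v vG auv u' uG uE => [|n] exT u v vG auv u' uG uE.
  by exists 0; rewrite ?rpred0 // -uE (cx_obj0 u') (cx_obj0 v) !linear0.
move=> wG /(exT n erefl _ wG)[t tG tE]; exists (u', t).
  by rewrite torsion_pair uG tG.
by rewrite cone_diffE uE tE subKr.
Qed.

Lemma cone_torsion_exact_below a T c : (forall n, (n < c)%N -> torsion_exact_at T n) ->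
  forall n, (n < c)%N -> torsion_exact_at (cone a T) n.
Proof.
move=> exT n nc [u v]; rewrite torsion_pair => /andP[uG vG] /cone_cocycle[du auv].
apply: cone_torsion_coboundary => //; last exact: exT.
by move=> k nk; apply: exT; apply: leq_trans nc; rewrite nk.
Qed.

(** Exactness of the fibre makes multiplication by [a] injective on torsion
    cohomology, while it is locally nilpotent. *)
Lemma torsion_exact_of_cone a T n : a \in m ->
  torsion_exact_at (cone a T) n -> torsion_exact_at T n.
Proof.
move=> am exC v vG; have [k] := torsion_expr am vG.
elim: k v vG => [|k IHk] v vG.
  by rewrite expr0 scale1r => -> _; exists 0; rewrite ?rpred0 ?linear0.
rewrite exprSr -scalerA => akv dv.
have [||t tG tE] := IHk (a *: v) _ akv; first by rewrite rpredZ.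
  by rewrite linearZ /= dv scaler0.
have [||[u1 u2]] := exC (v, t).
- by rewrite torsion_pair vG.
- exact/cone_cocycle.
by rewrite torsion_pair => /andP[u1G _] [<- _]; exists u1.
Qed.

Hypothesis nR : noetherian R.
Hypothesis mI : ideal m.

(** Torsion cohomology injects into cohomology, by the contraction one degree
    below. *)
Lemma torsion_coboundary_lift K n (v : K n.+1) : (forall k, injective_module (K k)) ->
    (forall k, (k < n)%N -> {in m, forall a, nilpotent_at K k a}) ->
    v \in Gamma -> (exists u, d u = v) ->
  exists2 u, u \in Gamma & d u = v.
Proof.
move=> injK nilK vG [u uE]; case: n nilK v vG u uE => [|n] nilK v vG u uE.
  by exists 0; rewrite ?rpred0 // -uE (cx_obj0 u).
have [|h hP] := @torsion_contraction R m nR mI K n injK; first exact: nilK.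
exists (u - d (h u)); first by rewrite hP // uE.
by rewrite linearB cx_diffK subr0.
Qed.

Lemma torsion_exact_of_exact K n : (forall k, injective_module (K k)) ->
    (forall k, (k < n)%N -> {in m, forall a, nilpotent_at K k a}) ->
  exact_at K n -> torsion_exact_at K n.
Proof.
by move=> injK nilK exK v vG dv; apply: torsion_coboundary_lift => //; exact: exK.
Qed.

End TorsionCohomology.
End ConeCohomology.

(** * Koszul complexes of a complex *)

Section IteratedCone.
Variable R : comNzRingType.
Implicit Types (T : complex R) (s : seq R).

(** The cohomological Koszul complex of the [n]-th powers of [s] on [T]. The exponent
    is kept apart from the sequence so that complexes for different exponents
    have their augmentation in convertible degrees. *)
Fixpoint kos n s T : complex R :=
  if s is a :: s' then kos n s' (cone (a ^+ n) T) else T.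

(** [kos_top s c = c + size s]; this form of it makes the next definition
    well typed. *)
Fixpoint kos_top s c : nat := if s is _ :: s' then kos_top s' c.+1 else c.

Lemma kos_topE s c : kos_top s c = (size s + c)%N.
Proof. by elim: s c => //= a s IHs c; rewrite IHs addSnnS. Qed.

Fixpoint kos_aug (M : lmodType R) n s T c :
    {linear M -> T c.+1} -> {linear M -> kos n s T (kos_top s c).+1} :=
  if s is a :: s'
  then fun e => @kos_aug M n s' (cone (a ^+ n) T) c.+1 (@cone_in R (a ^+ n) T c.+1 \o e)
  else id.

Fixpoint kos_proj n s T k : {linear kos n s T k -> T k} :=
  if s is a :: s'
  then (fst : {linear (T k * T k.-1)%type -> T k}) \o @kos_proj n s' (cone (a ^+ n) T) k
  else idfun.

Fixpoint add_span (M : lmodType R) n s (N : M -> Prop) : M -> Prop :=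
  if s is a :: s' then add_span n s' (add_multiples (a ^+ n) N) else N.

Lemma kos_resolves_from M n s T c e N : @resolves_from R M T c e N ->
  resolves_from (kos_aug n s e) (add_span n s N).
Proof.
elim: s T c e N => //= a s IHs T c e N eN.
exact/IHs/cone_resolves_from.
Qed.

Lemma kos_exact_below M n s T c e N : @resolves_from R M T c e N ->
    (forall k, (k < size s)%N -> forall w,
       add_span n (take k s) N (s`_k ^+ n *: w) -> add_span n (take k s) N w) ->
    (forall k, (k < c)%N -> exact_at T k) ->
  forall k, (k < kos_top s c)%N -> exact_at (kos n s T) k.
Proof.
elim: s T c e N => //= a s IHs T c e N eN regN exT.
apply: IHs (cone_resolves_from (a ^+ n) eN) _ _ => [k ks|].
  exact: (regN k.+1).
by apply: cone_exact_below eN _ exT; exact: (regN 0%N).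
Qed.

Lemma kos_injective n s T : (forall k, injective_module (T k)) ->
  forall k, injective_module (kos n s T k).
Proof.
elim: s T => //= a s IHs T injT; apply: IHs => k.
exact: injective_pair.
Qed.

Lemma kos_nilpotent n s T b : (forall k, nilpotent_at T k b) ->
  forall k, nilpotent_at (kos n s T) k b.
Proof.
by elim: s T => //= a s IHs T nilT; apply: IHs; exact: cone_nilpotent.
Qed.

Lemma kos_nilpotent_self n s T b : b \in s -> forall k, nilpotent_at (kos n s T) k b.
Proof.
elim: s T => //= a s IHs T; rewrite inE => /predU1P[->|/IHs]; last exact.
by apply: kos_nilpotent => k; exact: cone_nilpotent_self.
Qed.

(** On top of applying [phi], [psi] multiplies each component by the entries of [s]
    which do not index it: by 1 where the augmentation lands, which gives the
    projection between the quotients of [M], and by the product of all of [s]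
    on [T] itself, which gives the transition map of local homology. *)
Lemma kos_change_power (M : lmodType R) n s T T' c (e : {linear M -> T c.+1})
    (e' : {linear M -> T' c.+1}) (phi : forall k, {linear T k -> T' k}) :
    (forall k v, phi k.+1 (cx_diff v) = cx_diff (phi k v)) ->
    (forall w, phi _ (e w) = e' w) ->
  exists psi : forall k, {linear kos n.+1 s T k -> kos n s T' k},
    [/\ forall k v, psi k.+1 (cx_diff v) = cx_diff (psi k v),
        forall w, psi _ (kos_aug n.+1 s e w) = kos_aug n s e' w &
        forall k v, kos_proj n s T' k (psi k v) =
                    (\prod_(a <- s) a) *: phi k (kos_proj n.+1 s T k v)].
Proof.
elim: s T T' c e e' phi => [|a s IHs] T T' c e e' phi phid phie.
  by exists phi; split=> // k v; rewrite big_nil scale1r.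
pose f k (p : cone (a ^+ n.+1) T k) : cone (a ^+ n) T' k := (a *: phi k p.1, phi k.-1 p.2).
have fL k : linear (f k).
  move=> b [u v] [u' v']; congr pair; rewrite /= linearP //.
  by rewrite scalerDr !scalerA mulrC.
pose g k : {linear cone (a ^+ n.+1) T k -> cone (a ^+ n) T' k} :=
  HB.pack (f k) (GRing.isLinear.Build R _ _ *:%R (f k) (fL k)).
have phi_prev k (v : T k.-1) : phi k (cx_prev v) = cx_prev (phi k.-1 v).
  by case: k v => [|k] v /=; rewrite ?linear0 // phid.
have [||psi [psid psie psip]] := IHs _ _ c.+1
  (@cone_in R (a ^+ n.+1) T c.+1 \o e) (@cone_in R (a ^+ n) T' c.+1 \o e') g.
- move=> k [u v]; congr pair; rewrite /=; first by rewrite linearZ phid.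
  by rewrite linearB phi_prev [phi k (_ *: _)]linearZ /= scalerA exprSr.
- by move=> w; congr pair; rewrite /= ?phie // linear0 scaler0.
exists psi; split=> // k v; rewrite big_cons /=.
by rewrite psip /= scalerA mulrC.
Qed.

Section Torsion.
Variable m : {pred R}.
Local Notation Gamma := (torsion m (V := _)).

Lemma torsion_exact_of_kos n s T k : {in s, forall a, a ^+ n \in m} ->
  torsion_exact_at m (kos n s T) k -> torsion_exact_at m T k.
Proof.
elim: s T => //= a s IHs T sm /IHs exC.
apply: (torsion_exact_of_cone (sm a (mem_head _ _))); apply: exC.
by move=> b sb; apply: sm; rewrite inE sb orbT.
Qed.

Definition torsion_cocycle T k (v : T k.+1) := v \in Gamma /\ cx_diff v = 0.
Definition torsion_coboundary T k (v : T k.+1) :=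
  exists2 u : T k, u \in Gamma & cx_diff u = v.
Arguments torsion_coboundary : clear implicits.
Arguments torsion_cocycle : clear implicits.

Lemma torsion_coboundaryB T k u v : torsion_coboundary T k u ->
  torsion_coboundary T k v -> torsion_coboundary T k (u - v).
Proof.
by move=> [u' uG <-] [v' vG <-]; exists (u' - v'); rewrite ?linearB ?rpredB.
Qed.

Lemma torsion_coboundaryZ T k a u : torsion_coboundary T k u ->
  torsion_coboundary T k (a *: u).
Proof. by move=> [u' uG <-]; exists (a *: u'); rewrite ?linearZ ?rpredZ. Qed.

Lemma torsion_cocycleZ T k a u : torsion_cocycle T k u -> torsion_cocycle T k (a *: u).
Proof. by move=> [uG du]; split; rewrite ?rpredZ // linearZ /= du scaler0. Qed.

Section LowestDegree.
Variable c : nat.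

(** In the lowest degree, the torsion cohomology of the fibre of [a] is the
    kernel of [a] on that of [T]. *)
Lemma cone_fst_inj a T : (forall k, (k < c)%N -> torsion_exact_at m T k) ->
  forall z : cone a T c.+1, torsion_cocycle _ _ z ->
  torsion_coboundary T c z.1 -> torsion_coboundary (cone a T) c z.
Proof.
move=> exT [u v] [zG /cone_cocycle[du auv]] uB.
move: zG; rewrite torsion_pair => /andP[uG vG].
by apply: cone_torsion_coboundary => // k ck; apply: exT; rewrite ck.
Qed.

Lemma cone_fst_surj a T v : torsion_cocycle T c v -> torsion_coboundary T c (a *: v) ->
  exists2 z : cone a T c.+1, torsion_cocycle _ _ z & z.1 = v.
Proof.
move=> [vG dv] [u uG uE]; exists (v, u) => //; split.
  by rewrite torsion_pair vG.
by apply/cone_cocycle.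
Qed.

Lemma cone_fst_kernel a T (z : cone a T c.+1) : torsion_cocycle _ _ z ->
  torsion_cocycle T c z.1 /\ torsion_coboundary T c (a *: z.1).
Proof.
case: z => u v [zG /cone_cocycle[du auv]].
by move: zG; rewrite torsion_pair => /andP[uG vG]; split=> //; exists v.
Qed.

Lemma cone_fst_coboundary a T (z : cone a T c.+1) : torsion_coboundary _ _ z ->
  torsion_coboundary T c z.1.
Proof.
by move=> [[u v]]; rewrite torsion_pair => /andP[uG vG] <-; exists u.
Qed.

Lemma kos_proj_cocycle n s T z : torsion_cocycle (kos n s T) c z ->
  torsion_cocycle T c (kos_proj n s T c.+1 z).
Proof. by elim: s T z => //= a s IHs T z /IHs/cone_fst_kernel[]. Qed.

Lemma kos_proj_coboundary n s T z : torsion_coboundary (kos n s T) c z ->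
  torsion_coboundary T c (kos_proj n s T c.+1 z).
Proof. by elim: s T z => //= a s IHs T z /IHs/cone_fst_coboundary. Qed.

Lemma kos_proj_inj n s T z : (forall k, (k < c)%N -> torsion_exact_at m T k) ->
    torsion_cocycle (kos n s T) c z ->
    torsion_coboundary T c (kos_proj n s T c.+1 z) ->
  torsion_coboundary (kos n s T) c z.
Proof.
elim: s T z => //= a s IHs T z exT zC zB; apply: IHs => //.
  exact: cone_torsion_exact_below.
by apply: cone_fst_inj => //; exact: kos_proj_cocycle.
Qed.

Lemma kos_proj_kernel n s T z : torsion_cocycle (kos n s T) c z ->
  {in s, forall a, torsion_coboundary T c (a ^+ n *: kos_proj n s T c.+1 z)}.
Proof.
elim: s T z => //= a s IHs T z zC b; rewrite inE => /predU1P[->|sb].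
  by have [] := cone_fst_kernel (kos_proj_cocycle zC).
by have := cone_fst_coboundary (IHs _ _ zC b sb).
Qed.

Lemma kos_proj_surj n s T v : (forall k, (k < c)%N -> torsion_exact_at m T k) ->
    torsion_cocycle T c v -> {in s, forall a, torsion_coboundary T c (a ^+ n *: v)} ->
  exists2 z, torsion_cocycle (kos n s T) c z &
    torsion_coboundary T c (v - kos_proj n s T c.+1 z).
Proof.
elim: s T v => [|a s IHs] T v exT vC sB.
  by exists v; rewrite //= subrr; exists 0; rewrite ?rpred0 ?linear0.
have [w wC wE] := cone_fst_surj vC (sB a (mem_head _ _)).
have [|b sb|z zC zB] := IHs (cone (a ^+ n) T) w _ wC.
- exact: cone_torsion_exact_below.
- apply: cone_fst_inj => //; first exact: torsion_cocycleZ.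
  by rewrite /= wE; apply: sB; rewrite inE sb orbT.
by exists z => //; have := cone_fst_coboundary zB; rewrite /= wE.
Qed.

End LowestDegree.

Section Coregular.
Variable V : lmodType R.

(** Coregular sequences on [Z / B], in terms of representatives, so that the notion
    applies to cocycles modulo coboundaries. *)
Fixpoint coregular s (Z B : V -> Prop) : Prop :=
  if s is a :: s' then
    (forall z, Z z -> exists2 z', Z z' & B (z - a *: z')) /\
    coregular s' (fun z => Z z /\ B (a *: z)) B
  else True.
End Coregular.

Lemma coregular_nth (V : lmodType R) s (Z B : V -> Prop) k z : coregular s Z B ->
    (k < size s)%N -> Z z -> (forall j, (j < k)%N -> B (s`_j *: z)) ->
  exists z', [/\ Z z', forall j, (j < k)%N -> B (s`_j *: z') & B (z - s`_k *: z')].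
Proof.
elim: s Z k => // a s IHs Z [|k] /= [aS cs] ks Zz zB.
  by have [z' Zz' zz'] := aS z Zz; exists z'.
have [|z' [[Zz' az'] z'B zz']] := IHs _ k cs ks (conj Zz (zB 0%N isT)).
  by move=> j jk; exact: (zB j.+1).
by exists z'; split=> // -[|j] // jk; exact: z'B.
Qed.

(** [f] induces an isomorphism from [Z' / B'] to [Z / B]. *)
Lemma coregular_transfer (V V' : lmodType R) (f : {linear V' -> V}) s
    (Z B : V -> Prop) (Z' B' : V' -> Prop) :
    (forall u v, B u -> B v -> B (u - v)) -> (forall a u, B u -> B (a *: u)) ->
    (forall z, Z' z -> Z (f z)) -> (forall z, B' z -> B (f z)) ->
    (forall z, Z' z -> B (f z) -> B' z) ->
    (forall a z, Z' z -> Z' (a *: z)) ->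
    (forall z, Z z -> exists2 z', Z' z' & B (z - f z')) ->
  coregular s Z' B' -> coregular s Z B.
Proof.
move=> BB BZ; elim: s Z Z' => //= a s IHs Z Z' fZ fB fBK Z'Z fS [aS cs].
split=> [z Zz|].
  have [z' Z'z' zz'] := fS z Zz; have [y Z'y z'y] := aS z' Z'z'.
  exists (f y); first exact: fZ.
  rewrite -[z - _](subrKA (f z')) -[f z' - _]opprK; apply: BB => //.
  by rewrite -(scaleN1r (f z' - _)); apply: BZ; rewrite -linearZ -linearB; exact: fB.
apply: IHs cs => //.
- by move=> z [Z'z Bz]; split; [exact: fZ | rewrite -linearZ; exact: fB].
- by move=> z [Z'z _]; exact: fBK.
- move=> b z [Z'z Bz]; split; first exact: Z'Z.
  apply: fBK; first by do 2 apply: (Z'Z).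
  by rewrite scalerA mulrC -scalerA linearZ /=; apply: (BZ); exact: fB.
move=> z [Zz Bz]; have [z' Z'z' zz'] := fS z Zz; exists z' => //; split=> //.
apply: fBK; first exact: Z'Z.
rewrite linearZ /= -(subKr (a *: z) (a *: f z')) -scalerBr.
by apply: BB => //; exact: BZ.
Qed.

(** Exactness of a fibre one degree above [c] says that its entry is onto, and its
    cohomology in degree [c] is the kernel on which the next entry acts. *)
Lemma kos_coregular c n s T : {in s, forall a, a ^+ n \in m} ->
    (forall k, (k < c)%N -> torsion_exact_at m T k) ->
    torsion_exact_at m (kos n s T) c.+1 ->
  coregular [seq a ^+ n | a <- s] (torsion_cocycle T c) (torsion_coboundary T c).
Proof.
elim: s T => //= a s IHs T sm exT exK.
have sm' : {in s, forall b, b ^+ n \in m}.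
  by move=> b sb; apply: sm; rewrite inE sb orbT.
have exC := torsion_exact_of_kos sm' exK.
split=> [v [vG dv]|].
  have [||[u w]] := exC (0, v).
  - by rewrite torsion_pair rpred0.
  - by apply/cone_cocycle; rewrite linear0 scaler0.
  rewrite torsion_pair => /andP[uG wG] [du vE].
  by exists u => //; exists (- w); rewrite ?rpredN // -vE [LHS]linearN addrAC subrr add0r.
have cs := IHs _ sm' (cone_torsion_exact_below exT) exK.
apply: (coregular_transfer
  (f := (fst : {linear (T c.+1 * T c)%type -> T c.+1})) _ _ _ _ _ _ _ cs).
- exact: torsion_coboundaryB.
- exact: torsion_coboundaryZ.
- by move=> z /cone_fst_kernel[zC zB]; split.
- by move=> z /cone_fst_coboundary.
- by move=> z; exact: cone_fst_inj.
- by move=> b z; exact: torsion_cocycleZ.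
move=> z [zC zB]; have [z' z'C z'E] := cone_fst_surj zC zB; exists z' => //=.
by rewrite z'E subrr; exists 0; rewrite ?rpred0 ?linear0.
Qed.

End Torsion.
End IteratedCone.

(** * Koszul homology of a coregular sequence *)

Section KoszulHomology.
Variables (R : comNzRingType) (r : nat) (X : lmodType R) (a : 'I_r -> R).
Implicit Types (f g : koszul r X) (S T : {set 'I_r}) (p : int).

(** The terms which remove the same two indices in opposite orders cancel. *)
Lemma koszul_diffK f : koszul_diff a (koszul_diff a f) = 0.
Proof.
apply/ffunP => T; rewrite !ffunE.
pose F (j l : 'I_r) := ((-1) ^+ #|[set k in T | (k < j)%N]| * a j) *:
  (((-1) ^+ #|[set k in j |: T | (k < l)%N]| * a l) *: f (l |: (j |: T))).
have anti (j l : 'I_r) : j \notin T -> l \notin T -> (j < l)%N -> F l j = - F j l.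
  move=> jT lT jl; rewrite /F !scalerA finset.setUCA -scaleNr; congr (_ *: _).
  have -> : [set k in j |: T | (k < l)%N] = j |: [set k in T | (k < l)%N].
    by apply/setP => k; rewrite !inE andb_orl; case: eqVneq => // ->; rewrite jl.
  have -> : [set k in l |: T | (k < j)%N] = [set k in T | (k < j)%N].
    apply/setP => k; rewrite !inE andb_orl; case: eqVneq => // ->.
    by rewrite ltnNge (ltnW jl) /= andbF.
  rewrite cardsU1 inE (negPf jT) /= add1n exprS.
  by ring.
transitivity (\sum_(q : 'I_r * 'I_r | [&& q.1 \notin T, q.2 \notin T & q.1 != q.2]) F q.1 q.2).
  under eq_bigr do rewrite ffunE scaler_sumr.
  rewrite pair_big_dep /=; apply: eq_bigl => -[j l] /=.
  rewrite !inE negb_or andbC [l == j]eq_sym andbA.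
  by case: (j \notin T); rewrite ?andbF ?andbT //= andbC.
rewrite (bigID (fun q : 'I_r * 'I_r => (q.1 < q.2)%N)) /=.
rewrite [X in _ + X](reindex_inj (h := fun q : 'I_r * 'I_r => (q.2, q.1))) /=; last first.
  by move=> [? ?] [? ?] [-> ->].
rewrite [X in _ + X](eq_big
  (fun q : 'I_r * 'I_r => [&& q.1 \notin T, q.2 \notin T & q.1 != q.2] && (q.1 < q.2)%N)
  (fun q => - F q.1 q.2)) /=.
- by rewrite sumrN addrN.
- move=> [j l] /=; rewrite [l == j]eq_sym -leqNgt leq_eqVlt andbCA -!andbA.
  by rewrite -[j == l :> nat]/(j == l); case: eqVneq => //=; rewrite ?andbF.
by move=> [j l] /= /andP[/and3P[lT jT lj] ljn]; apply: anti => //;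
   rewrite ltn_neqAle eq_sym lj leqNgt.
Qed.

Lemma koszul_diff_deg p g : koszul_deg (p + 1) g -> koszul_deg p (koszul_diff a g).
Proof.
move=> gp T; rewrite ffunE => nz.
have [j jT /gp] : exists2 j, j \notin T & g (j |: T) <> 0.
  apply: contrapT => h; apply: nz; rewrite big1 // => j jT.
  suff -> : g (j |: T) = 0 by rewrite scaler0.
  by apply: contrapT => gj; apply: h; exists j.
by rewrite cardsU1 jT add1n -addn1 PoszD => /addIr.
Qed.

Hypothesis coreg : forall (k : 'I_r) (v : X),
  (forall j : 'I_r, (j < k)%N -> a j *: v = 0) ->
  exists w, (forall j : 'I_r, (j < k)%N -> a j *: w = 0) /\ a k *: w = v.

(** The form of a cycle once the indices below [k] are eliminated; for [k = r] only
    the coefficient in degree [r] is left. *)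
Definition koszul_cleared (k : nat) f :=
  (forall S (j : 'I_r), (j < k)%N -> j \notin S -> f S = 0) /\
  (forall S (j : 'I_r), (j < k)%N -> a j *: f S = 0).

(** The chain [g] divides by [a i] the values of [f] on the sets without [i], which
    coregularity allows; its values are still killed by the earlier [a j], so
    that its boundary disturbs nothing else. Once these values of [f] are
    cancelled, the cycle condition says that [a i] kills the remaining ones. *)
Lemma koszul_clear p (i : 'I_r) f :
    koszul_deg p f -> koszul_diff a f = 0 -> koszul_cleared i f ->
  exists g, [/\ koszul_deg (p + 1) g, koszul_deg p (f - koszul_diff a g),
    koszul_diff a (f - koszul_diff a g) = 0 & koszul_cleared i.+1 (f - koszul_diff a g)].
Proof.
move=> fp df [f0 fa].
have /choice[W WP] : forall S, exists w : X,
    [/\ forall j : 'I_r, (j < i)%N -> a j *: w = 0, a i *: w = f S & f S = 0 -> w = 0].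
  move=> S; have [fS0|fS0] := EM (f S = 0).
    by exists 0; split=> // *; rewrite scaler0 ?fS0.
  by have [w [wa wi]] := coreg (fun j => fa S j); exists w.
pose sgn S := (-1) ^+ #|[set k in S | (k < i)%N]| : R.
pose g : koszul r X := [ffun S : {set 'I_r} => if i \in S then sgn (S :\ i) *: W (S :\ i) else 0].
have gW (S : {set 'I_r}) : (i \in S) = false -> g S = 0 by move=> iS; rewrite ffunE iS.
have ga S (j : 'I_r) : (j < i)%N -> a j *: g S = 0.
  move=> ji; rewrite ffunE; case: ifP => _; last by rewrite scaler0.
  by have [wa _ _] := WP (S :\ i); rewrite scalerA mulrC -scalerA wa // scaler0.
have g0 (S : {set 'I_r}) (j : 'I_r) : (j < i)%N -> j \notin S -> g S = 0.
  move=> ji jS; rewrite ffunE; case: ifP => // _.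
  have [_ _ ->] := WP (S :\ i); rewrite ?scaler0 //.
  by apply: (f0 _ j ji); rewrite !inE (negPf jS) andbF.
have gp : koszul_deg (p + 1) g.
  move=> S; rewrite ffunE; case: ifP => // iS gS.
  rewrite (cardsD1 i) iS add1n -addn1 PoszD fp // => fS.
  by apply: gS; have [_ _ ->] := WP (S :\ i); rewrite ?scaler0.
have dgE (T : {set 'I_r}) : i \notin T -> koszul_diff a g T = f T.
  move=> iT; rewrite ffunE (bigD1 i) //= big1 ?addr0 => [|j /andP[jT ji]]; last first.
    by rewrite gW ?scaler0 // !inE (negPf iT) eq_sym (negPf ji).
  rewrite ffunE setU11 setU1K // scalerA /sgn mulrAC -expr2 sqrr_sign mul1r.
  by have [_ -> _] := WP T.
have dg0 (T : {set 'I_r}) (j : 'I_r) : (j < i)%N -> j \notin T -> koszul_diff a g T = 0.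
  move=> ji jT; rewrite ffunE big1 // => l lT.
  have [->|lj] := eqVneq l j; first by rewrite -scalerA ga // scaler0.
  by rewrite (g0 _ j) ?scaler0 // !inE (negPf jT) eq_sym (negPf lj).
have dga T (j : 'I_r) : (j < i)%N -> a j *: koszul_diff a g T = 0.
  move=> ji; rewrite ffunE scaler_sumr big1 // => l lT.
  by rewrite scalerA mulrC -scalerA ga // scaler0.
have dcyc : koszul_diff a (f - koszul_diff a g) = 0.
  by rewrite linearB /= df koszul_diffK subr0.
have subE T : (f - koszul_diff a g) T = f T - koszul_diff a g T.
  by rewrite !ffunE.
have i0 (T : {set 'I_r}) : i \notin T -> (f - koszul_diff a g) T = 0.
  by move=> iT; rewrite subE dgE // subrr.
exists g; split=> //.
  rewrite addrC -scaleN1r; apply: koszul_deg_linear => //.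
  exact: koszul_diff_deg.
split=> S j; rewrite ltnS leq_eqVlt => /predU1P[/val_inj->|ji].
- exact: i0.
- by move=> jS; rewrite subE (f0 _ j) // (dg0 _ j) // subrr.
- have [iS|/i0->] := boolP (i \in S); last by rewrite scaler0.
  have /ffunP/(_ (S :\ i)) := dcyc; rewrite [LHS]ffunE [RHS]ffunE.
  rewrite (bigD1 i) ?setD11 //= big1 ?addr0 => [|l /andP[lS li]]; last first.
    by rewrite i0 ?scaler0 // !inE eq_sym (negPf li) eqxx.
  rewrite finset.setD1K // => /(congr1 (fun v => sgn (S :\ i) *: v)).
  by rewrite !scalerA mulrA -expr2 sqrr_sign mul1r scaler0.
by rewrite subE scalerBr fa // dga // subrr.
Qed.

Lemma koszul_coregular_exact p : p != r%:Z ->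
  {subset @koszul_cycle R r X a p <= koszul_boundary a p}.
Proof.
move=> pr f /asboolP[fp df]; apply/asboolP.
have : forall k, (k <= r)%N -> exists g, [/\ koszul_deg (p + 1) g,
    koszul_deg p (f - koszul_diff a g), koszul_diff a (f - koszul_diff a g) = 0 &
    koszul_cleared k (f - koszul_diff a g)].
  elim=> [|k IHk] kr.
    exists 0; rewrite [koszul_diff a 0]linear0 subr0; split=> //.
    exact: koszul_deg0.
  have [g [gp fgp fgd fgk]] := IHk (ltnW kr).
  have [h [hp fhp fhd fhk]] := koszul_clear fgp fgd (fgk : koszul_cleared (Ordinal kr) _).
  exists (1 *: g + h); rewrite scale1r linearD opprD addrA; split=> //.
  by rewrite -[g]scale1r; exact: koszul_deg_linear.
move=> /(_ r (leqnn r))[g [gp fgp _ [fg0 _]]]; exists g; split=> //.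
apply/eqP; rewrite eq_sym -subr_eq0; apply/eqP/ffunP => S; rewrite [RHS]ffunE.
apply: contrapT => nz; move: pr; rewrite -(fgp S nz).
suff -> : S = [set: 'I_r]%SET by rewrite cardsT card_ord eqxx.
apply/setP => j; rewrite inE; apply: contrapT => /negP jS.
by apply: nz; apply: (fg0 S j).
Qed.

End KoszulHomology.

Section KoszulTop.
Variables (R : comNzRingType) (r : nat) (X : lmodType R).
Implicit Type a : 'I_r -> R.

(** There are no chains of degree greater than [r], and those of degree [r] have
    a single coefficient. *)
Definition koszul_top_coef a (h : koszul_homology X a r%:Z) : X :=
  sub_mod_val (quot_repr h) [set: 'I_r]%SET.

Lemma koszul_deg_top f : @koszul_deg R r X r%:Z f ->
  forall S, S != [set: 'I_r]%SET -> f S = 0.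
Proof.
move=> fr S; apply: contra_neq_eq => /eqP/fr[Sr].
by apply/eqP; rewrite eqEcard finset.subsetT cardsT card_ord Sr leqnn.
Qed.

Lemma koszul_boundary_top a f : f \in @koszul_boundary R r X a r%:Z -> f = 0.
Proof.
case/asboolP=> g [gr <-]; suff -> : g = 0 by rewrite linear0.
apply/ffunP => S; rewrite ffunE; apply: contrapT => /gr.
rewrite -PoszD addn1 => -[Sr].
by have := max_card (mem S); rewrite card_ord Sr ltnn.
Qed.

Lemma koszul_top_coefE a (f : sub_mod (koszul_cycle a r%:Z)) :
  koszul_top_coef (quot_pi _ f : koszul_homology X a r%:Z) = val f [set: 'I_r]%SET.
Proof.
have := quot_reprE (preim_submod
  (val : {linear sub_mod (@koszul_cycle R r X a r%:Z) -> _}) (koszul_boundary a r%:Z)) f.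
rewrite unfold_in => /koszul_boundary_top/ffunP/(_ [set: 'I_r]%SET).
by rewrite !ffunE => /subr0_eq.
Qed.

Lemma koszul_top_coef_linear a : linear (@koszul_top_coef a).
Proof.
move=> c g h; rewrite -[g]quot_reprK -[h]quot_reprK -linearP !koszul_top_coefE.
by rewrite /= !ffunE.
Qed.
HB.instance Definition _ a := GRing.isLinear.Build R (koszul_homology X a r%:Z) X *:%R
  (@koszul_top_coef a) (@koszul_top_coef_linear a).

Lemma koszul_top_coef_inj a (h : koszul_homology X a r%:Z) :
  koszul_top_coef h = 0 -> h = 0.
Proof.
rewrite -[h]quot_reprK koszul_top_coefE; case: (quot_repr h) => f fC /= f0.
have fE : f = 0.
  have /asboolP[fr _] := fC; apply/ffunP => S; rewrite [RHS]ffunE.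
  by have [->//|] := eqVneq S [set: 'I_r]%SET; exact: koszul_deg_top.
by rewrite -[RHS](linear0 (quot_pi _)); congr quot_pi; apply: val_inj.
Qed.

Lemma koszul_top_coef_kernel a (h : koszul_homology X a r%:Z) j :
  a j *: koszul_top_coef h = 0.
Proof.
rewrite -[h]quot_reprK koszul_top_coefE; case: (quot_repr h) => f /= /asboolP[fr].
move/ffunP/(_ [set~ j]%SET); rewrite [LHS]ffunE [RHS]ffunE (bigD1 j) /= ?setC11 //.
rewrite big1 ?addr0 => [|i /andP[]]; last by rewrite !inE negbK => /eqP->; rewrite eqxx.
have -> : (j |: ~: [set j] = [set: 'I_r])%SET.
  by apply/setP => k; rewrite !inE orbN.
rewrite -scalerA => /(congr1 (fun v => (-1) ^+ #|[set k in [set~ j]%SET | (k < j)%N]| *: v)).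
by rewrite scalerA -expr2 sqrr_sign scale1r scaler0.
Qed.

Lemma koszul_top_coef_surj a v : (forall j, a j *: v = 0) ->
  exists h : koszul_homology X a r%:Z, koszul_top_coef h = v.
Proof.
move=> av; pose f : koszul r X := [ffun S : {set 'I_r} => if S == [set: 'I_r]%SET then v else 0].
have fC : f \in koszul_cycle a r%:Z.
  apply/asboolP; split=> [S|].
    by rewrite ffunE; case: eqP => // -> _; rewrite cardsT card_ord.
  apply/ffunP => S; rewrite ffunE big1 ?ffunE // => j _; rewrite ffunE.
  by case: ifP => _; rewrite -scalerA ?av !scaler0.
by exists (quot_pi _ (SubMod fC)); rewrite koszul_top_coefE /= ffunE eqxx.
Qed.

Lemma koszul_top_coef_trans (x : r.-tuple R) n h :
  koszul_top_coef (koszul_trans X x n r%:Z h) = (\prod_(a <- x) a) *: koszul_top_coef h.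
Proof.
rewrite -[h]quot_reprK [koszul_trans _ _ _ _ _]quot_mod_mapE !koszul_top_coefE /= ffunE.
congr (_ *: _); rewrite big_tuple; apply: eq_bigl => j; by rewrite inE.
Qed.

End KoszulTop.

(** * Quotients and completion *)

Section AddSpan.
Variables (R : comNzRingType) (M : lmodType R).
Implicit Types (N : M -> Prop) (s : seq R).

Lemma add_span_sub n s N (P : {pred M}) : submod_closed P ->
    (forall w, N w -> w \in P) -> {in s, forall a w, a ^+ n *: w \in P} ->
  forall w, add_span n s N w -> w \in P.
Proof.
move=> [P0 PC]; elim: s N => //= a s IHs N NP sP; apply: IHs => [w [w' /NP wP]|b sb].
  rewrite -[w](subrK (a ^+ n *: w')) -[w - _]scale1r; apply: PC => //.
  by apply: sP; exact: mem_head.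
by apply: sP; rewrite inE sb orbT.
Qed.

Lemma add_span_incl n s N w : N 0 -> N w -> add_span n s N w.
Proof.
elim: s N w => //= a s IHs N w N0 Nw; apply: IHs.
  by exists 0; rewrite scaler0 subr0.
by exists 0; rewrite scaler0 subr0.
Qed.

Lemma add_span_mem n s N a w : N 0 -> a \in s -> add_span n s N (a ^+ n *: w).
Proof.
elim: s N => //= b s IHs N N0.
have N0' : add_multiples (b ^+ n) N 0 by exists 0; rewrite scaler0 subr0.
rewrite inE => /predU1P[->|]; last exact: IHs.
by apply: add_span_incl => //; exists w; rewrite subrr.
Qed.

Lemma add_span_submod n s N : submod_closed (fun w => `[< N w >] : bool) ->
  submod_closed (fun w => `[< add_span n s N w >] : bool).
Proof.
elim: s N => //= a s IHs N [N0 NC]; apply: IHs; split.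
  by apply/asboolP; exists 0; rewrite scaler0 subr0; exact/asboolP.
move=> c u v /asboolP[u' Nu] /asboolP[v' Nv]; apply/asboolP; exists (c *: u' + v').
have -> : c *: u + v - a ^+ n *: (c *: u' + v') =
    c *: (u - a ^+ n *: u') + (v - a ^+ n *: v').
  by rewrite scalerDr scalerBr opprD addrACA !scalerA mulrC.
by apply/asboolP; apply: NC; apply/asboolP.
Qed.

Definition zero_pred : M -> Prop := fun w => w = 0.

Lemma add_span_zero_submod n s :
  submod_closed (fun w => `[< add_span n s zero_pred w >] : bool).
Proof.
apply: add_span_submod; split; first exact/asboolP.
by move=> a u v /asboolP-> /asboolP->; apply/asboolP; rewrite scaler0 addr0.
Qed.

Lemma add_span_ideal_smul s w :
  add_span 1 s zero_pred w <-> w \in ideal_smul (ideal_gen s) (predT : {pred M}).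
Proof.
have [P0 PC] := add_span_zero_submod 1 s.
split=> [|wI].
  apply: add_span_sub => [|_ ->|a sa v]; first exact: gen_submod_closed.
    exact: rpred0.
  rewrite expr1; apply: mem_gen_submod; apply/asboolP; exists a, v; split=> //.
  exact: mem_gen_submod.
apply/asboolP; move: wI; apply: (gen_submod_min (add_span_zero_submod 1 s)).
move=> _ /asboolP[c [u [cI _ ->]]].
pose I : {pred R} := fun c => `[< add_span 1 s zero_pred (c *: u) >].
suff: c \in I by [].
apply: (@gen_submod_min R R^o (mem s) I _ _ c cI).
  split; first by rewrite unfold_in scale0r.
  by move=> a b b' bI b'I; rewrite unfold_in scalerDl -scalerA; exact: PC.
by move=> a sa; apply/asboolP; rewrite -[a]expr1; exact: add_span_mem.
Qed.

Lemma add_span_adic (m : {pred R}) n s w : {subset s <= m} ->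
  add_span n s zero_pred w -> w \in adic_sub m n.
Proof.
move=> sm; apply: add_span_sub => [|_ ->|a sa v]; first exact: gen_submod_closed.
  exact: rpred0.
apply: mem_gen_submod; apply/asboolP; exists (a ^+ n), v; split=> //.
by apply: expr_ideal_pow; exact: sm.
Qed.

Lemma adic_add_span (m : {pred R}) n s :
    noetherian R -> is_local m -> finitely_generated M -> finite_length (quot_seq M s) ->
  exists k, forall w, w \in adic_sub m k -> add_span n.+1 s zero_pred w.
Proof.
move=> nR lR fg fl; have PS := add_span_zero_submod n.+1 s; have [P0 PC] := PS.
pose I : {pred R} := fun c => `[< forall w, add_span n.+1 s zero_pred (c *: w) >].
have [|a sa|b /asboolP bM|N NP] := parameters_ideal_pow (I := I) nR lR fg fl.
- split; first by apply/asboolP => w; rewrite scale0r; exact/asboolP.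
  move=> a b c /asboolP bI /asboolP cI; apply/asboolP => w.
  by rewrite scalerDl -scalerA; apply/asboolP; apply: PC; exact/asboolP.
- by exists n.+1; apply/asboolP => w; exact: add_span_mem.
- by exists 1%N; apply/asboolP => w; rewrite expr1 bM; exact/asboolP.
exists N => w wN; apply/asboolP; move: wN; apply: (gen_submod_min PS).
by move=> _ /asboolP[c [u [/NP/asboolP cI _ ->]]]; exact/asboolP.
Qed.

End AddSpan.

Section Quotients.
Variable R : comNzRingType.

Lemma quot_pi_eq0 (V : lmodType R) (N : submodClosed V) v :
  quot_pi N v = 0 <-> v \in (N : {pred V}).
Proof.
have := quot_piE N v 0; rewrite linear0 subr0 => <-.
by split=> [->|/eqP].
Qed.

Lemma subquot_trivial (V : lmodType R) (Z B : submodClosed V) :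
  {subset (Z : {pred V}) <= (B : {pred V})} -> forall q : subquot Z B, q = 0.
Proof.
move=> ZB q; rewrite -[q]quot_reprK; apply/quot_pi_eq0.
by rewrite unfold_in; apply: ZB; exact: valP.
Qed.

Lemma isomorphic_zero (U V : lmodType R) :
  (forall u : U, u = 0) -> (forall v : V, v = 0) -> isomorphic U V.
Proof. by move=> U0 V0; exists \0, (fun=> 0) => [u|v]; rewrite ?(U0 u) ?(V0 v). Qed.

Lemma zero_mod0 (v : zero_mod R) : v = 0.
Proof. exact: thinmx0. Qed.

Lemma inv_lim_trivial (H : nat -> lmodType R) (phi : forall n, {linear H n.+1 -> H n}) :
  (forall n (h : H n), h = 0) -> forall u : inv_lim phi, u = 0.
Proof. by move=> H0 u; apply: inv_lim_inj => n; rewrite (H0 n (inv_lim_proj u n)). Qed.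

Lemma isomorphic_of_relation (U V : lmodType R) (Rel : U -> V -> Prop) :
    linear_relation Rel -> (forall v, Rel 0 v -> v = 0) -> (forall u, Rel u 0 -> u = 0) ->
    (forall u, exists v, Rel u v) -> (forall v, exists u, Rel u v) ->
  isomorphic U V.
Proof.
move=> RL Rf Ri Rt /choice[g gP]; have [f fP] := linear_of_relation RL Rf Rt.
have [Rel0 RelC] := RL.
have sub u v u' v' : Rel u v -> Rel u' v' -> Rel (u - u') (v - v').
  move=> uv uv'; rewrite -[u - u']addrC -[v - v']addrC -!scaleN1r; exact: RelC.
exists f, g => [u|v]; apply/eqP; rewrite -subr_eq0; apply/eqP.
  by apply: Ri; rewrite -(subrr (f u)); exact: sub.
by apply: Rf; rewrite -(subrr (g v)); exact: sub.
Qed.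

(** The [H n] are the quotients of [M] by a family of submodules cofinal with the
    [m ^ n M], so both limits are the completion of [M] for the same topology. *)
Lemma completion_cofinal (m : {pred R}) (M : lmodType R) (H : nat -> lmodType R)
    (phi : forall n, {linear H n.+1 -> H n}) (theta : forall n, {linear M -> H n}) :
    (forall n h, exists w, theta n w = h) ->
    (forall n w, phi n (theta n.+1 w) = theta n w) ->
    (forall n w, theta n w = 0 -> w \in adic_sub m n.+1) ->
    (forall n, exists N, forall w, w \in adic_sub m N -> theta n w = 0) ->
  isomorphic (inv_lim phi) (completion m M).
Proof.
move=> thS phiT low /choice[N NP].
have adic_le k l (w : M) : (k <= l)%N -> w \in adic_sub m l -> w \in adic_sub m k.
  move=> kl wl; exact: (@ideal_smulS R M M idfun (ideal_pow m l) (ideal_pow m k)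
    predT predT (ideal_pow_le kl) (fun _ _ => isT) w wl).
have projE (u : inv_lim phi) n k w : (n <= k)%N ->
    theta k w = inv_lim_proj u k -> theta n w = inv_lim_proj u n.
  move=> /subnK <-; elim: (k - n)%N => // l IHl e; apply: IHl.
  by rewrite -phiT -inv_lim_compat e.
(* Representatives at all levels are chosen at once: the kernel of [theta n] lies in
   [m ^ n.+1 M], which is the level of [eta] that it determines. *)
pose Rel (u : inv_lim phi) (eta : inv_lim (adic_trans m M)) :=
  forall n, exists w, theta n w = inv_lim_proj u n /\
    quot_pi _ w = inv_lim_proj eta n.+1 :> adic_quot m M n.+1.
apply: (@isomorphic_of_relation _ (completion m M) Rel).
- split; first by move=> n; exists 0; rewrite !linear0.
  move=> a u eta u' eta' ueta ueta' n; have [w [wE we]] := ueta n.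
  have [w' [wE' we']] := ueta' n; exists (a *: w + w').
  by split; [rewrite linearP wE wE' | rewrite [LHS]linearP /= we we'].
- move=> eta eta0; have etaS n : inv_lim_proj eta n.+1 = 0.
    by have [w [/low w0 <-]] := eta0 n; exact/quot_pi_eq0.
  apply: inv_lim_inj => -[|n]; last by rewrite etaS.
  by rewrite -inv_lim_compat etaS linear0.
- move=> u u0; apply: inv_lim_inj => n.
  have [w [wE /quot_pi_eq0 w0]] := u0 (maxn n (N n)).
  rewrite -(projE u n _ w (leq_maxl n (N n)) wE); apply: NP.
  by apply: adic_le w0; apply: leqW; exact: leq_maxr.
- move=> u; have /choice[w wE] := fun n => thS n (inv_lim_proj u n).
  have wS n : theta n (w n.+1) = inv_lim_proj u n by exact: (projE u n n.+1).
  have eC n : adic_trans m M n (quot_pi _ (w n.+1)) = quot_pi _ (w n).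
    rewrite [LHS]quot_mod_mapE; apply/eqP; rewrite quot_piE.
    by apply: adic_le (leqnSn n) _; apply: low; rewrite linearB wS wE subrr.
  exists (InvLim eC) => n; exists (w n.+1); split=> //.
move=> eta.
have /choice[v vE] : forall n, exists v : M,
    quot_pi _ v = inv_lim_proj eta n :> adic_quot m M n.
  by move=> n; exists (quot_repr (inv_lim_proj eta n)); rewrite quot_reprK.
have vle k l : (k <= l)%N -> quot_pi _ (v l) = inv_lim_proj eta k :> adic_quot m M k.
  move=> /subnK <-; elim: (l - k)%N => [|j IHj] //; rewrite -IHj addSn.
  apply/eqP; rewrite quot_piE; apply: (adic_le _ (j + k)%N); first exact: leq_addl.
  rewrite -quot_piE vE -inv_lim_compat -vE; apply/eqP.
  by rewrite [RHS]quot_mod_mapE.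
have thv n l : (N n <= l)%N -> theta n (v l) = theta n (v (N n)).
  move=> nl; apply/eqP; rewrite -subr_eq0 -linearB; apply/eqP; apply: NP.
  by rewrite -quot_piE vE vle.
have uC n : phi n (theta n.+1 (v (N n.+1))) = theta n (v (N n)).
  by rewrite -(thv n.+1 (maxn (N n) (N n.+1))) ?leq_maxr // phiT thv // leq_maxl.
exists (InvLim (H := H) (phi := phi) uC) => n /=; exists (v (maxn (N n) n.+1)); split.
  by rewrite thv // leq_maxl.
by rewrite vle // leq_maxr.
Qed.

End Quotients.

(** * Local cohomology from the resolution *)

Section Resolution.
Variables (R : comNzRingType) (M : lmodType R) (E : injective_resolution M).

Definition res_complex_obj n : lmodType R := if n is k.+1 then E k else zero_mod R.
Definition res_complex_diff n : {linear res_complex_obj n -> res_complex_obj n.+1} :=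
  match n with 0 => \0 | k.+1 => res_diff E k end.
Lemma res_complex_diffK n v : res_complex_diff n.+1 (res_complex_diff n v) = 0.
Proof.
case: n v => [|n] v /=; first by rewrite linear0.
by apply/res_exactS; exists v.
Qed.
Definition res_complex := Complex res_complex_diffK (@zero_mod0 R).

Lemma res_complex_resolves :
  resolves_from (T := res_complex) (c := 0) (res_aug E) (@zero_pred R M).
Proof.
split=> [w|v /res_exact0[w <-]|w|[//|n] _ v /res_exactS//].
- by apply/res_exact0; exists w.
- by exists w, 0; rewrite linear0 addr0.
split=> [->|[u]]; first by exists 0; rewrite !linear0.
by move/esym; rewrite -[cx_diff u]/(0 : E 0%N) -(linear0 (res_aug E)) => /res_aug_inj.
Qed.

Lemma res_complex_injective k : injective_module (res_complex k).
Proof.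
case: k => [|k]; last exact: res_injective.
by apply: injective_trivial; exact: zero_mod0.
Qed.

Lemma res_complex_annihilator b : b \in annihilator M ->
  forall k, nilpotent_at res_complex k b.
Proof.
move=> /asboolP bM [|k] v dv; last first.
  by have [u uE] := (res_exactS v).1 dv; exists 1%N, (b *: u); rewrite linearZ /= uE.
have [w wE] := (res_exact0 v).1 dv; exists 1%N, 0.
by rewrite linear0 -wE -linearZ bM linear0.
Qed.

Variable m : {pred R}.

Lemma lc_cocycleP n (v : E n) :
  v \in lc_cocycle m (E := E) (n := n) <-> torsion_cocycle m (T := res_complex) (k := n) v.
Proof. by split=> [/andP[vG /eqP dv]|[vG dv]]; [|apply/andP; split=> //; apply/eqP]. Qed.

Lemma lc_coboundaryP n (v : E n) :
  v \in lc_coboundary m (E := E) (n := n) <->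
  torsion_coboundary m (T := res_complex) (k := n) v.
Proof.
case: n v => [|n] v; last first.
  by split=> [/asboolP[u [uG uE]]|[u uG uE]]; [exists u | apply/asboolP; exists u].
split=> [/eqP->|[u _ <-]]; first by exists 0; rewrite ?rpred0.
exact/eqP.
Qed.

Lemma local_cohomology_trivial n : torsion_exact_at m res_complex n ->
  forall h : local_cohomology m E (Posz n), h = 0.
Proof.
move=> exT; apply: subquot_trivial => v /lc_cocycleP[vG dv].
by apply/lc_coboundaryP; exact: exT.
Qed.

End Resolution.

(** * Top local cohomology of a module with a system of parameters *)

Section Comparison.
Variables (R : comNzRingType) (m : {pred R}) (M : lmodType R) (E : injective_resolution M).
Variable s : seq R.
Local Notation Gamma := (torsion m (V := _)).
Local Notation T := (res_complex E).
Local Notation D := (kos_top s 0).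
Local Notation aug n := (kos_aug n s (T := T) (c := 0) (res_aug E)).
Local Notation proj n := (kos_proj n s T D.+1).

Hypotheses (nR : noetherian R) (lR : is_local m) (fgM : finitely_generated M).
Hypotheses (sm : {subset s <= m}) (fl : finite_length (quot_seq M s)).
Hypothesis depthM : forall k, (k < D)%N -> torsion_exact_at m T k.

Let mI : ideal m.
Proof. by case: lR => [[[m0 _ mC] _] _]; split=> // a u v; exact: mC. Qed.

Let smX n : {in s, forall a, a ^+ n.+1 \in m}.
Proof. by move=> a /sm am; rewrite exprSr; exact: idealM. Qed.

Let kosI n := @kos_injective R n s T (@res_complex_injective R M E).

(** The elements with a power killing a given class contain the entries of [s] and
    the annihilator of [M], hence [m] as [s] is a system of parameters. *)
Lemma kos_res_nilpotent n k : {in m, forall a, nilpotent_at (kos n s T) k a}.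
Proof.
move=> a am v dv.
pose I : {pred R} := fun c => `[< exists u, cx_diff u = c *: v >].
have [|b sb|b bM|N NP] := parameters_ideal_pow (I := I) nR lR fgM fl.
- split; first by apply/asboolP; exists 0; rewrite linear0 scale0r.
  move=> c b b' /asboolP[u uE] /asboolP[u' uE']; apply/asboolP; exists (c *: u + u').
  by rewrite linearP uE uE' scalerDl scalerA.
- by have [j jv] := @kos_nilpotent_self R n s T b sb k v dv; exists j; apply/asboolP.
- have [j jv] := @kos_nilpotent R n s T b (res_complex_annihilator bM) k v dv.
  by exists j; apply/asboolP.
by exists N; apply/asboolP; apply: NP; exact: expr_ideal_pow.
Qed.

Let resolves n := kos_resolves_from n s (res_complex_resolves E).

Lemma kos_res_exact_above n k : (D < k)%N -> torsion_exact_at m (kos n s T) k.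
Proof.
have [_ _ _ exK] := resolves n => Dk.
apply: (torsion_exact_of_exact nR mI (@kosI n) _ (exK k Dk)) => j _.
exact: kos_res_nilpotent.
Qed.

(** Below [D] by depth, and above because the Koszul complex has no cohomology
    there. *)
Lemma res_torsion_exact k : k != D -> torsion_exact_at m T k.
Proof.
rewrite neq_ltn => /orP[/depthM//|Dk].
exact: (@torsion_exact_of_kos R m 1 s T k (smX 0) (kos_res_exact_above Dk)).
Qed.

(** [koszul_lift n w v]: the class of [v] in the top local cohomology
    corresponds to that of [w] in [M / (s ^ n) M], both being obtained from a
    same torsion cocycle of the Koszul complex of the resolution. *)
Definition koszul_lift n (w : M) (v : T D.+1) :=
  exists z u, [/\ z \in Gamma, z = aug n w + cx_diff u & v = proj n z].

Lemma koszul_lift_linear n : linear_relation (koszul_lift n).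
Proof.
split; first by exists 0, 0; rewrite rpred0 !linear0 addr0.
move=> a w v w' v' [z [u [zG zE ->]]] [z' [u' [zG' zE' ->]]].
exists (a *: z + z'), (a *: u + u'); split; last by rewrite linearP.
  by rewrite rpredD ?rpredZ.
by rewrite [aug n _]linearP [cx_diff _]linearP zE zE' scalerDr addrACA.
Qed.

Lemma koszul_lift_cocycle n w v : koszul_lift n w v ->
  exists z u, [/\ torsion_cocycle m z, z = aug n w + cx_diff u & v = proj n z].
Proof.
move=> [z [u [zG zE vE]]]; exists z, u; split=> //; split=> //.
have [augC _ _ _] := resolves n.
by rewrite zE linearD /= augC cx_diffK addr0.
Qed.

Lemma koszul_lift_total n w : exists v, koszul_lift n w v.
Proof.
have [h hP] := torsion_contraction nR mI (@kosI n)
  (fun k (_ : (k <= D)%N) => @kos_res_nilpotent n k).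
have [augC _ _ _] := resolves n.
exists (proj n (aug n w - cx_diff (h (aug n w)))), (aug n w - cx_diff (h (aug n w))).
exists (- h (aug n w)); split=> //; last by rewrite linearN.
by apply: hP; rewrite augC rpred0.
Qed.

Lemma koszul_lift_kernel n w v : koszul_lift n w v ->
  torsion_cocycle m v /\ {in s, forall a, torsion_coboundary m (a ^+ n *: v)}.
Proof.
move=> /koszul_lift_cocycle[z [u [zC _ ->]]]; split.
  exact: kos_proj_cocycle.
exact: kos_proj_kernel.
Qed.

Lemma koszul_lift_onto n v : torsion_cocycle m v ->
    {in s, forall a, torsion_coboundary m (a ^+ n *: v)} ->
  exists w v', koszul_lift n w v' /\ torsion_coboundary m (v - v').
Proof.
move=> vC vs; have [z [zG dz] zB] := kos_proj_surj depthM vC vs.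
have [_ augG _ _] := resolves n; have [w [u zE]] := augG z dz.
by exists w, (proj n z); split=> //; exists z, u.
Qed.

Lemma koszul_lift_coboundary n w v : koszul_lift n w v ->
  torsion_coboundary m v <-> add_span n s (@zero_pred R M) w.
Proof.
move=> /koszul_lift_cocycle[z [u [zC zE ->]]]; have [_ _ augN _] := resolves n.
split=> [/(kos_proj_inj depthM zC)[t _ tE]|/augN[t tE]].
  by apply/augN; exists (t - u); rewrite linearB tE zE addrK.
apply: kos_proj_coboundary.
apply: (torsion_coboundary_lift nR mI (@kosI n)) (proj1 zC) _ => [k _|].
  exact: kos_res_nilpotent.
by exists (t + u); rewrite linearD tE zE.
Qed.

Lemma koszul_lift_change_power n w v :
  koszul_lift n.+1 w v -> koszul_lift n w ((\prod_(a <- s) a) *: v).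
Proof.
move=> [z [u [zG zE ->]]].
have [//|//|psi [psid psie psip]] := @kos_change_power R M n s T T 0%N (res_aug E)
  (res_aug E) (fun k => idfun).
exists (psi _ z), (psi _ u); split; first exact: torsion_linear.
  by rewrite zE linearD psie psid.
by rewrite psip.
Qed.

Section TopCohomology.
Variables (r : nat) (x : r.-tuple R).
Hypothesis xs : s = x.
Local Notation X := (local_cohomology m E (Posz D)).
Local Notation cocycles := (sub_mod (lc_cocycle m (E := E) (n := D))).
Local Notation H n := (koszul_homology X (tuple_pow x n.+1) r%:Z).

Definition lc_class (v : cocycles) : X := quot_pi _ v.
Let lc_classL a u v : lc_class (a *: u + v) = a *: lc_class u + lc_class v.
Proof. exact: quot_pi_linear. Qed.

Let lc_class0 : lc_class 0 = 0.
Proof. by have := lc_classL (- 1) 0 0; rewrite !scaleN1r oppr0 addr0 addNr. Qed.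

Let lc_classZ a v : lc_class (a *: v) = a *: lc_class v.
Proof. by rewrite -[a *: v]addr0 lc_classL lc_class0 addr0. Qed.

Let lc_classB u v : lc_class (u - v) = lc_class u - lc_class v.
Proof. by rewrite [u - v]addrC -(scaleN1r v) lc_classL scaleN1r addrC. Qed.

Let lc_class_eq0 (v : cocycles) :
  lc_class v = 0 <-> torsion_coboundary m (T := T) (k := D) (val v).
Proof. by rewrite -lc_coboundaryP; exact: quot_pi_eq0. Qed.

Let valZ a (v : cocycles) : val (a *: v) = a *: val v :> E D.
Proof. exact: (linearZZ (val : {linear cocycles -> E D})). Qed.

Let valB (u v : cocycles) : val (u - v) = val u - val v :> E D.
Proof. exact: (raddfB (val : {linear cocycles -> E D})). Qed.

Let lc_class_scale_eq0 a (v : cocycles) :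
  a *: lc_class v = 0 <-> torsion_coboundary m (T := T) (k := D) (a *: val v).
Proof.
by rewrite -lc_classZ lc_class_eq0 valZ.
Qed.

Let lc_class_eq (u v : cocycles) :
  lc_class u = lc_class v <-> torsion_coboundary m (T := T) (k := D) (val u - val v).
Proof.
rewrite -valB -lc_class_eq0 lc_classB.
by split=> [e|/subr0_eq//]; rewrite [X in X - _]e subrr.
Qed.

Let lc_classP (h : X) : exists2 v : cocycles,
  lc_class v = h & torsion_cocycle m (T := T) (k := D) (val v).
Proof.
exists (quot_repr h); first exact: quot_reprK.
by apply/lc_cocycleP; exact: valP.
Qed.

Let cocycleS (v : T D.+1) : torsion_cocycle m v -> exists v' : cocycles, val v' = v.
Proof. by move=> /lc_cocycleP vC; exists (SubMod vC). Qed.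

Let tuple_powP n (j : 'I_r) : exists2 a, a \in s & tuple_pow x n j = a ^+ n.
Proof. by exists (tnth x j); rewrite // xs; exact: mem_tnth. Qed.

Lemma local_cohomology_coregular n (k : 'I_r) (h : X) :
    (forall j : 'I_r, (j < k)%N -> tuple_pow x n.+1 j *: h = 0) ->
  exists h' : X, (forall j : 'I_r, (j < k)%N -> tuple_pow x n.+1 j *: h' = 0) /\
    tuple_pow x n.+1 k *: h' = h.
Proof.
have cs := kos_coregular (smX n) depthM (@kos_res_exact_above n.+1 D.+1 (ltnSn D)).
have nthE (j : 'I_r) : [seq a ^+ n.+1 | a <- s]`_j = tuple_pow x n.+1 j.
  by rewrite xs (nth_map 0) ?size_tuple // -tnth_nth.
have [v <- vC] := lc_classP h => hj.
have [||v' [/cocycleS[w <-] wj wk]] := coregular_nth (k := k) cs _ vC.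
- by rewrite size_map xs size_tuple.
- move=> j jk; have jr := ltn_trans jk (ltn_ord k).
  by rewrite (nthE (Ordinal jr)); apply/lc_class_scale_eq0; exact: hj.
exists (lc_class w); split=> [j jk|].
  by apply/lc_class_scale_eq0; rewrite -nthE; exact: wj.
rewrite -lc_classZ; apply/esym/lc_class_eq.
by rewrite valZ -nthE.
Qed.

Let top_coef0 n : koszul_top_coef (0 : H n) = 0.
Proof.
have := koszul_top_coef_linear (- 1) (0 : H n) 0.
by rewrite !scaleN1r oppr0 addr0 addNr.
Qed.

(* The graph of the projection of [M] onto [M / (s ^ n.+1) M], identified with
   the top Koszul homology of top local cohomology. *)
Let lift_class n w (h : H n) := exists v : cocycles,
  koszul_lift n.+1 w (val v) /\ koszul_top_coef h = lc_class v.

Let lift_class_eq0 n w (h : H n) : lift_class w h ->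
  h = 0 <-> add_span n.+1 s (@zero_pred R M) w.
Proof.
move=> [v [wv hv]]; rewrite -(koszul_lift_coboundary wv) -lc_class_eq0 -hv.
by split=> [->|]; [exact: top_coef0 | exact: koszul_top_coef_inj].
Qed.

Let lift_class_linear n : linear_relation (@lift_class n).
Proof.
have [L0 LC] := koszul_lift_linear n.+1; split.
  by exists 0; split; [exact: L0 | rewrite lc_class0; exact: top_coef0].
move=> a w h w' h' [v [wv hv]] [v' [wv' hv']]; exists (a *: v + v'); split.
  exact: LC.
by rewrite lc_classL -hv -hv'; exact: koszul_top_coef_linear.
Qed.

Let lift_class_total n w : exists h, @lift_class n w h.
Proof.
have [v wv] := koszul_lift_total n.+1 w; have [vC vs] := koszul_lift_kernel wv.
have [v' vE] := cocycleS vC; rewrite -vE in wv vs.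
have [j|h hv] := @koszul_top_coef_surj R r X (tuple_pow x n.+1) (lc_class v').
  by have [a /vs as_ ->] := tuple_powP n.+1 j; apply/lc_class_scale_eq0.
by exists h, v'.
Qed.

Let lift_class_onto n (h : H n) : exists w, lift_class w h.
Proof.
have [v vh vC] := lc_classP (koszul_top_coef h).
have [|w [v' [wv' vv']]] := koszul_lift_onto (n := n.+1) vC.
  move=> a as_; have /tnthP[j ->] : a \in x by rewrite -[a \in x]/(a \in tval x) -xs.
  by apply/lc_class_scale_eq0; rewrite vh; exact: koszul_top_coef_kernel.
have [u uE] := cocycleS (proj1 (koszul_lift_kernel wv')).
exists w, u; rewrite uE -vh; split=> //; apply/lc_class_eq.
by rewrite uE.
Qed.

Let lift_class_trans n w (h : H n.+1) : lift_class w h ->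
  lift_class w (koszul_trans X x n.+1 r%:Z h).
Proof.
move=> [v [wv hv]]; exists ((\prod_(a <- s) a) *: v); split.
  exact: koszul_lift_change_power.
by rewrite koszul_top_coef_trans hv -xs lc_classZ.
Qed.

Lemma local_homology_top_cohomology :
  isomorphic (local_homology X x r%:Z) (completion m M).
Proof.
have z0 : @zero_pred R M 0 by [].
have fun0 n (h : H n) : lift_class 0 h -> h = 0.
  by move=> /lift_class_eq0 ->; exact: add_span_incl.
pose theta n := sval (cid (linear_of_relation (lift_class_linear n)
  (@fun0 n) (@lift_class_total n))).
have thetaP n w : lift_class w (theta n w) by rewrite /theta; case: cid => f /=.
have uniq n w (h h' : H n) : lift_class w h -> lift_class w h' -> h' = h.
  have [_ LC] := lift_class_linear n => wh wh'; apply/eqP; rewrite -subr_eq0 addrC.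
  apply/eqP/fun0; rewrite -(addNr w) -[- w]scaleN1r -[- h]scaleN1r; exact: LC.
apply: (completion_cofinal (H := fun n => H n) (theta := theta)) => n.
- move=> h; have [w wh] := lift_class_onto h; exists w.
  exact: uniq wh (thetaP n w).
- move=> w; exact: uniq (thetaP n w) (lift_class_trans (thetaP n.+1 w)).
- by move=> w /(lift_class_eq0 (thetaP n w)); exact: add_span_adic.
have [N NP] := adic_add_span n nR lR fgM fl; exists N => w /NP.
by move/(lift_class_eq0 (thetaP n w)).
Qed.

End TopCohomology.
End Comparison.

(** * Cohen-Macaulay modules *)

Section Depth.
Variables (R : comNzRingType) (m : {pred R}) (M : lmodType R) (E : injective_resolution M).

(** The Koszul complex of [y] on the resolution is exact below the degree which is
    the length of [y], hence so is its torsion subcomplex, and this goes back to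
    the torsion of the resolution as the entries of [y] are in [m]. *)
Lemma regular_torsion_exact (y : seq R) : noetherian R -> ideal m -> {subset y <= m} ->
    regular_sequence M y ->
  forall k, (k < kos_top y 0)%N -> torsion_exact_at m (res_complex E) k.
Proof.
move=> nR mI ym [reg _] k ky.
have exK l : (l < kos_top y 0)%N -> exact_at (kos 1 y (res_complex E)) l.
  apply: (kos_exact_below (res_complex_resolves E)) => // j jy w.
  rewrite expr1 => /add_span_ideal_smul yw; apply/add_span_ideal_smul.
  have := reg j jy (quot_pi _ w); rewrite -linearZ /=.
  by move=> yreg; apply/quot_pi_eq0/yreg/quot_pi_eq0.
apply: (@torsion_exact_of_kos R m 1 y); first by move=> a ya; rewrite expr1; exact: ym.
apply: (torsion_exact_of_exact nR mI _ _ (exK k ky)).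
  by apply: kos_injective; exact: res_complex_injective.
move=> l lk a _ v dv; have [u uE] := exK l (ltn_trans lk ky) v dv.
by exists 0%N, u; rewrite expr0 scale1r.
Qed.

End Depth.

Lemma is_largest_uniq P n k : is_largest P n -> is_largest P k -> n = k.
Proof.
by move=> [Pn nP] [Pk kP]; apply/eqP; rewrite eqn_leq nP // kP.
Qed.

Theorem theorem3p1 (R : comNzRingType) (m : {pred R}) (M : lmodType R)
    (d : nat) (x : d.-tuple R) (E : injective_resolution M) :
  noetherian R -> is_local m -> finitely_generated M ->
  has_dim M d -> system_of_parameters m M x -> cohen_macaulay m M ->
  forall i j : int,
    isomorphic (local_homology (local_cohomology m E j) x i)
               (if (i == d%:Z) && (j == d%:Z) then completion m M
                else zero_mod R).
Proof.
move=> nR lR fgM dimM [_ xm fl] [n [[[y [yn ym yreg]] _] dimMn]] i j.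
have mI : ideal m.
  by case: (lR) => [[[m0 _ mC] _] _]; split=> // a u v; exact: mC.
have dE : d = kos_top x 0 by rewrite kos_topE size_tuple addn0.
have depthM k : (k < kos_top x 0)%N -> torsion_exact_at m (res_complex E) k.
  rewrite -dE (is_largest_uniq dimM dimMn) -yn => ky.
  by apply: (regular_torsion_exact nR mI ym yreg); rewrite kos_topE addn0.
have [jd|jd] := eqVneq j d%:Z; last first.
  rewrite andbF; apply: isomorphic_zero; last exact: zero_mod0.
  have h0 (h : local_cohomology m E j) : h = 0.
    case: j jd h => [j|j] jd h; last exact: zero_mod0.
    apply: local_cohomology_trivial h.
    by apply: (res_torsion_exact nR lR fgM xm fl depthM); rewrite -dE.
  apply: inv_lim_trivial => k; apply: subquot_trivial => f _.
  suff -> : f = 0 by rewrite rpred0.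
  by apply/ffunP => S; rewrite (h0 (f S)) ffunE.
rewrite andbT {}jd [in local_cohomology _ _ _]dE.
case: eqVneq => [->|id]; first exact: local_homology_top_cohomology.
apply: isomorphic_zero; last exact: zero_mod0.
apply: inv_lim_trivial => k; apply: subquot_trivial.
apply: koszul_coregular_exact id => l h.
exact: (local_cohomology_coregular nR lR fgM xm fl depthM).
Qed.
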